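(* Let $Z=(Z_1,\dots,Z_n)$ be a vector of mutually independent random variables taking values in a Polish space $\mathcal{Z}$ and let $\boldsymbol{H}:\mathcal{Z}\to\mathbb{H}^d$ be a measurable function with $\mathbb{E}\|\boldsymbol{H}(Z)-\mathbb{E}\,\boldsymbol{H}(Z)\|^2<\infty$. Assume there are deterministic matrices $\boldsymbol{A}_1,\dots,\boldsymbol{A}_n\in\mathbb{H}^d$ for which $$\big(\boldsymbol{H}(z_1,\dots,z_n)-\boldsymbol{H}(z_1,\dots,z_j',\dots,z_n)\big)^2\preccurlyeq\boldsymbol{A}_j^2\quad\text{for each index } j,$$ where $z_k$ and $z_k'$ range over all possible values of $Z_k$. Put $$\sigma^2=\Big\|\sum_{j=1}^n\boldsymbol{A}_j^2\Big\|.$$ Then for all $t\ge 0$, $$\mathbb{P}\big\{\lambda_{\max}\big(\boldsymbol{H}(Z)-\mathbb{E}\,\boldsymbol{H}(Z)\big)\ge t\big\}\le d\cdot e^{-t^2/(2\sigma^2)}.$$ Furthermore, $$\mathbb{E}\,\lambda_{\max}\big(\boldsymbol{H}(Z)-\mathbb{E}\,\boldsymbol{H}(Z)\big)\le\sigma\sqrt{2\log d}.$$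
   Context: $\mathbb{H}^d$ is the real-linear space of $d\times d$ complex Hermitian matrices; $\|\cdot\|$ is the spectral (operator) norm; $\preccurlyeq$ is the positive-semidefinite order on $\mathbb{H}^d$; $\lambda_{\max}$ is the maximum eigenvalue. The Polish space $\mathcal{Z}$ is the space of $n$-tuples in which $Z$ takes its values. In the expression $\boldsymbol{H}(z_1,\dots,z_j',\dots,z_n)$ only the $j$th argument $z_j$ has been replaced, by $z_j'$. *)

(* Defs.v *)
From HB Require Import structures.
From mathcomp Require Export all_boot all_order all_algebra.
From mathcomp Require Export complex.
From mathcomp Require Export all_classical all_reals all_analysis.
Set Implicit Arguments.
Unset Strict Implicit.
Unset Printing Implicit Defensive.
Export Order.TTheory GRing.Theory Num.Theory numFieldNormedType.Exports.
Local Open Scope classical_set_scope.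
Local Open Scope ring_scope.
Local Open Scope complex_scope.
Local Open Scope sesquilinear_scope.

Section Matrices.
Context {R : realType} {d : nat}.
Implicit Types (A B : 'M[R[i]]_d) (v : 'cV[R[i]]_d).

(* The order of R[i] is partial: 0 <= z means that z is real and nonnegative. *)
Definition psdmx A : Prop :=
  A \is hermsymmx /\ forall v, 0 <= (v^t* *m A *m v) 0 0.

Definition loewner_le A B : Prop := psdmx (B - A).

(* On Hermitian matrices of positive size the set is finite and nonempty, so
   that sup is a maximum. *)
Definition lambda_max A : R := sup [set x : R | eigenvalue A x%:C].

Definition l2norm v : R := Num.sqrt (\sum_(i < d) Normc.normc (v i 0) ^+ 2).

Definition specnorm A : R :=
  sup [set l2norm (A *m v) | v in [set v | l2norm v <= 1]].

End Matrices.

Definition polish {R : realType} (T : topologicalType) : Prop :=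
  (exists2 D : set T, countable D & dense D) /\
  exists dist : T -> T -> R,
    [/\ forall x y, dist x y = 0 <-> x = y,
        forall x y, dist x y = dist y x,
        forall x y z, dist x z <= dist x y + dist y z,
        forall x (U : set T), nbhs x U <->
          exists2 e : R, 0 < e & [set y | dist x y < e] `<=` U &
        forall u : nat -> T,
          (forall e : R, 0 < e -> exists N : nat, forall m k : nat,
             (N <= m)%N -> (N <= k)%N -> dist (u m) (u k) < e) ->
          exists l : T, u @ \oo --> l].
Arguments polish R T : clear implicits.

Notation borel T := (g_sigma_algebraType (@open T)).

(* Borel measurability for the topology of 'M[C]_d as R^(2 * d ^ 2). *)
Definition mx_measurable {dT : measure_display} {T : measurableType dT}
    {R : realType} {d : nat} (F : T -> 'M[R[i]]_d) : Prop :=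
  forall i k : 'I_d,
    measurable_fun setT (fun x => complex.Re (F x i k)) /\
    measurable_fun setT (fun x => complex.Im (F x i k)).

(* The entrywise expectation.  An entry whose expectation is infinite is sent to
   0 by fine; this does not happen when X - mx_expectation P X has a finite
   first moment. *)
Definition mx_expectation {dO : measure_display} {Omega : measurableType dO}
    {R : realType} (P : probability Omega R) {d : nat}
    (X : Omega -> 'M[R[i]]_d) : 'M[R[i]]_d :=
  \matrix_(i < d, k < d)
    (fine 'E_P[fun w => complex.Re (X w i k)] +i*
     fine 'E_P[fun w => complex.Im (X w i k)]).

Definition mutually_independent {dO : measure_display}
    {Omega : measurableType dO} {R : realType} (P : probability Omega R)
    {n : nat} {dT : 'I_n -> measure_display}
    {T : forall j : 'I_n, measurableType (dT j)}
    (Z : forall j : 'I_n, Omega -> T j) : Prop :=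
  forall (J : {set 'I_n}) (B : forall j : 'I_n, set (T j)),
    (forall j, measurable (B j)) ->
    P (\bigcap_(j in [set j | j \in J]) Z j @^-1` B j) =
    (\prod_(j in J) P (Z j @^-1` B j))%E.

(* Main.v *)
(* Stein's method of exchangeable pairs in trace form.  Let Z' be an independent
   copy of Z and X = H(Z) - E H(Z).  Replacing the coordinates of Z by those of
   Z' one at a time telescopes H(Z) - H(Z') into differences D_k, and exchanging
   Z_k with Z'_k flips the sign of D_k, so that
     E tr(X e^{th X}) = 1/2 sum_k E tr(D_k (e^{th X} - e^{th X^(k)})).
   A mean value inequality for traces, proved in the two eigenbases, bounds this
   by th sigma^2 E tr e^{th X}.  Since th |-> tr e^{th X} is convex, a discrete
   Gronwall argument gives E tr e^{th X} <= d e^{th^2 sigma^2 / 2}; the tail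
   bound is Markov's inequality, and the bound on the mean is Jensen's. *)
Require Import Defs.
From mathcomp Require Import ring lra finmap measurable_realfun.
Set Implicit Arguments.
Unset Strict Implicit.
Unset Printing Implicit Defensive.
Local Open Scope classical_set_scope.
Local Open Scope ring_scope.
Local Open Scope complex_scope.
Local Open Scope sesquilinear_scope.

(** The telescoping difference D_k and the increment X - X^(k) are different matrices, and neither
    need commute with X. This is why the mean value inequality involves three matrices: Young's
    inequality separates the two increments, each square is at most A_k^2, and the outcome is linear
    in A_k^2. The sum over k can then be formed before a norm is taken, which yields the norm of the
    sum and not the sum of the norms. One trace is left at X and one at X^(k); they have the same
    mean, which cancels the 1/2 of the exchange. The difference hypothesis speaks only of attained
    values of the Z_k. Hybrids of two attained points qualify again, and telescoping shows that H is
    bounded there, so that every integrand is bounded along the samples. The eigenvectors chosen for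
    a matrix need not depend on it measurably. Traces of exponentials are therefore treated as
    limits of polynomials in the entries, and [lambda_max] as a limit of logarithms of such traces.
    Invariance under the exchange is checked on boxes, which generate the Borel sets because the
    product is Polish. *)

(** * Real and imaginary parts of complex numbers *)

Section ComplexParts.
Context {R : realType}.
Implicit Types (z w : R[i]) (r : R).

Lemma ReD z w : complex.Re (z + w) = complex.Re z + complex.Re w.
Proof. by case: z w => [? ?] [? ?]. Qed.

Lemma ImD z w : complex.Im (z + w) = complex.Im z + complex.Im w.
Proof. by case: z w => [? ?] [? ?]. Qed.

Lemma ReN z : complex.Re (- z) = - complex.Re z.
Proof. by case: z. Qed.

Lemma ImN z : complex.Im (- z) = - complex.Im z.
Proof. by case: z. Qed.

Lemma ReM z w :
  complex.Re (z * w) = complex.Re z * complex.Re w - complex.Im z * complex.Im w.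
Proof. by case: z w => [? ?] [? ?]. Qed.

Lemma ImM z w :
  complex.Im (z * w) = complex.Re z * complex.Im w + complex.Im z * complex.Re w.
Proof. by case: z w => [? ?] [? ?]. Qed.

Lemma Re_sum (I : Type) (s : seq I) (p : pred I) (f : I -> R[i]) :
  complex.Re (\sum_(i <- s | p i) f i) = \sum_(i <- s | p i) complex.Re (f i).
Proof. by apply: (big_morph _ ReD). Qed.

Lemma Im_sum (I : Type) (s : seq I) (p : pred I) (f : I -> R[i]) :
  complex.Im (\sum_(i <- s | p i) f i) = \sum_(i <- s | p i) complex.Im (f i).
Proof. by apply: (big_morph _ ImD). Qed.

Lemma ReZ r z : complex.Re (r%:C * z) = r * complex.Re z.
Proof. by rewrite ReM /= mul0r subr0. Qed.

Lemma conjC_ReIm z : Num.conj z = complex.Re z -i* complex.Im z.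
Proof. by case: z. Qed.

Lemma conjC_real r : Num.conj r%:C = r%:C.
Proof. by rewrite conjC_ReIm /= oppr0. Qed.

Definition abs2 z : R := complex.Re z ^+ 2 + complex.Im z ^+ 2.

Lemma abs2_ge0 z : 0 <= abs2 z.
Proof. by rewrite addr_ge0 ?sqr_ge0. Qed.

Lemma abs2_conj z : abs2 (Num.conj z) = abs2 z.
Proof. by rewrite conjC_ReIm /abs2 /= sqrrN. Qed.

Lemma abs2M z w : abs2 (z * w) = abs2 z * abs2 w.
Proof. by rewrite /abs2 ReM ImM; ring. Qed.

Lemma abs2_normc z : Normc.normc z ^+ 2 = abs2 z.
Proof. by case: z => a b; rewrite sqr_sqrtr //= addr_ge0 ?sqr_ge0. Qed.

Lemma mulcJ_abs2 z : Num.conj z * z = (abs2 z)%:C.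
Proof.
by rewrite conjC_ReIm; case: z => a b; rewrite /abs2 -complexr0 /=; simpc; congr (_ +i* _); ring.
Qed.

Lemma Re_le_sqrt z : `|complex.Re z| <= Num.sqrt (abs2 z).
Proof. by rewrite -sqrtr_sqr ler_wsqrtr// lerDl sqr_ge0. Qed.

(** Young's inequality, from the squares of r Re z - Re w and r Im z + Im w. The weight [r] will be
    a signed eigenvalue gap, or the inner product to be bounded in Cauchy-Schwarz. *)
Lemma Re_mul_le z w r :
  r * complex.Re (z * w) <= (r ^+ 2 * abs2 z + abs2 w) / 2.
Proof.
rewrite ReM /abs2.
have := sqr_ge0 (r * complex.Re z - complex.Re w).
have := sqr_ge0 (r * complex.Im z + complex.Im w).
by nra.
Qed.

End ComplexParts.

(** * Quadratic forms of complex matrices *)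

Section QuadraticForm.
Context {R : realType} {d : nat}.
Implicit Types (A B C : 'M[R[i]]_d) (u v : 'cV[R[i]]_d) (t : R).

Definition dotc u v : R[i] := (u^t* *m v) 0 0.

Definition qform A v : R := complex.Re (dotc v (A *m v)).

Definition normsq v : R := \sum_(i < d) abs2 (v i 0).

Lemma qformE A v : qform A v = complex.Re ((v^t* *m A *m v) 0 0).
Proof. by rewrite /qform /dotc mulmxA. Qed.

Lemma dotcE u v : dotc u v = \sum_i Num.conj (u i 0) * v i 0.
Proof. by rewrite /dotc mxE; apply: eq_bigr => i _; rewrite !mxE. Qed.

Lemma dotcC u v : dotc v u = Num.conj (dotc u v).
Proof.
rewrite !dotcE rmorph_sum; apply: eq_bigr => i _.
by rewrite /= rmorphM /= conjCK mulrC.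
Qed.

Lemma dotcDr u v w : dotc u (v + w) = dotc u v + dotc u w.
Proof. by rewrite /dotc mulmxDr mxE. Qed.

Lemma dotcBr u v w : dotc u (v - w) = dotc u v - dotc u w.
Proof. by rewrite /dotc mulmxBr !mxE. Qed.

Lemma dotcZr u v (z : R[i]) : dotc u (z *: v) = z * dotc u v.
Proof. by rewrite /dotc -scalemxAr mxE. Qed.

Lemma dotc_normsq v : dotc v v = (normsq v)%:C.
Proof.
rewrite dotcE /normsq rmorph_sum; apply: eq_bigr => i _.
by rewrite mulcJ_abs2.
Qed.

Lemma normsq_ge0 v : 0 <= normsq v.
Proof. by apply: sumr_ge0 => i _; exact: abs2_ge0. Qed.

Lemma dotc_mul_adj A u v : dotc u (A *m v) = dotc (A^t* *m u) v.
Proof. by rewrite /dotc mulmxA trmx_mul map_mxM trmxCK. Qed.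

Lemma hermP A : A \is hermsymmx -> A^t* = A.
Proof. by move=> /is_hermitianmxP {2}->; rewrite scale1r. Qed.

Lemma hermI A : A^t* = A -> A \is hermsymmx.
Proof. by move=> h; apply/is_hermitianmxP; rewrite scale1r h. Qed.

Lemma dotc_herm A u v : A \is hermsymmx -> dotc u (A *m v) = dotc (A *m u) v.
Proof. by move=> /hermP h; rewrite dotc_mul_adj h. Qed.

Lemma qformD A B v : qform (A + B) v = qform A v + qform B v.
Proof. by rewrite /qform mulmxDl dotcDr ReD. Qed.

Lemma qformN A v : qform (- A) v = - qform A v.
Proof. by rewrite /qform mulNmx /dotc mulmxN mxE ReN. Qed.

Lemma qform_sum (I : Type) (s : seq I) (p : pred I) (F : I -> 'M[R[i]]_d) v :
  qform (\sum_(i <- s | p i) F i) v = \sum_(i <- s | p i) qform (F i) v.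
Proof.
apply: (big_morph (qform^~ v)) => [A B|]; first exact: qformD.
by rewrite /qform mul0mx /dotc mulmx0 mxE.
Qed.

Lemma qform_sqr A v : A \is hermsymmx -> qform (A ^+ 2) v = normsq (A *m v).
Proof.
by move=> hA; rewrite /qform expr2 -mulmxA dotc_herm// dotc_normsq.
Qed.

Lemma qform_loewner A B v : loewner_le A B -> qform A v <= qform B v.
Proof.
move=> [_ /(_ v)]; rewrite lecE => /andP[_] /=.
by rewrite -qformE qformD qformN subr_ge0.
Qed.

(** A crude norm that serves only to prove boundedness; its size enters no constant of the
    theorem. *)
Definition ent1norm A : R := \sum_i \sum_j (`|complex.Re (A i j)| + `|complex.Im (A i j)|).

Lemma ent1norm_ge0 A : 0 <= ent1norm A.
Proof. by apply: sumr_ge0 => i _; apply: sumr_ge0 => j _; rewrite addr_ge0. Qed.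

Lemma abs2_le1 v i : normsq v <= 1 -> abs2 (v i 0) <= 1.
Proof.
apply: le_trans; rewrite /normsq (bigD1 i)//= lerDl.
by apply: sumr_ge0 => j _; exact: abs2_ge0.
Qed.

Lemma qform_bound A v : normsq v <= 1 -> `|qform A v| <= ent1norm A.
Proof.
move=> v1; rewrite /qform dotcE Re_sum (le_trans (ler_norm_sum _ _ _))//.
apply: ler_sum => i _; rewrite mxE mulr_sumr Re_sum (le_trans (ler_norm_sum _ _ _))//.
apply: ler_sum => j _.
set a := A i j; set x := v i 0; set y := v j 0.
have xy1 : abs2 (Num.conj x * y) <= 1.
  by rewrite abs2M abs2_conj mulr_ile1 ?abs2_ge0 ?abs2_le1.
have -> : Num.conj x * (a * y) = a * (Num.conj x * y) by ring.
move: (Num.conj x * y) xy1 => w w1; rewrite ReM.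
have [Re1 Im1] : `|complex.Re w| <= 1 /\ `|complex.Im w| <= 1.
  rewrite /abs2 in w1; rewrite -!sqrtr_sqr -sqrtr1.
  by split; rewrite ler_wsqrtr//; apply: le_trans w1; rewrite ?lerDl ?lerDr sqr_ge0.
rewrite (le_trans (ler_normB _ _))// !normrM lerD//.
  by rewrite ler_piMr.
by rewrite ler_piMr.
Qed.

End QuadraticForm.

(** * Eigenbases and traces of functions of a Hermitian matrix *)

Section Eigenbasis.
Context {R : realType} {d : nat}.
Implicit Types (A B C : 'M[R[i]]_d) (u v : 'cV[R[i]]_d).

(** The spectral theorem reads A = S^-1 diag S with S = [spectralmx A] unitary, so the basis
    consists of the columns of the adjoint of S. It is orthonormal for every [A], and made of
    eigenvectors when [A] is Hermitian. *)
Definition eigvec A (i : 'I_d) : 'cV[R[i]]_d := (row i (spectralmx A))^t*.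
Definition eigval A (i : 'I_d) : R := complex.Re (spectral_diag A 0 i).

Lemma eigvec_ortho A i j : dotc (eigvec A i) (eigvec A j) = (i == j)%:R.
Proof.
have /unitarymxP/matrixP/(_ i j) := spectral_unitarymx A.
rewrite [RHS]mxE => <-; rewrite /dotc /eigvec trmxCK !mxE.
by apply: eq_bigr => k _; rewrite !mxE.
Qed.

Lemma eigvec_complete A : \sum_i eigvec A i *m (eigvec A i)^t* = 1%:M.
Proof.
have U := spectral_unitarymx A.
have {1}-> : 1%:M = (spectralmx A)^t* *m spectralmx A.
  by rewrite -invmx_unitary// mulVmx// unitarymx_unit.
apply/matrixP => a b; rewrite summxE [RHS]mxE; apply: eq_bigr => i _.
by rewrite mxE big_ord1 /eigvec trmxCK !mxE.
Qed.

Lemma eigvec_eq A i : A \is hermsymmx ->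
  A *m eigvec A i = (eigval A i)%:C *: eigvec A i.
Proof.
move=> hA; have /hermitian_normalmx/orthomx_spectralP := hA.
have U := spectral_unitarymx A.
set S := spectralmx A in U *; rewrite invmx_unitary// => AE.
have uE : eigvec A i = S^t* *m delta_mx i 0.
  by rewrite -colE; apply/matrixP => a b; rewrite !mxE.
rewrite {1}AE uE -!mulmxA (mulmxA S) (unitarymxP _) ?trmxC_unitary// mul1mx scalemxAr.
congr (_ *m _); apply/matrixP => a b; rewrite !mxE (bigD1 i)//= big1 ?addr0.
  rewrite !mxE eqxx ord1/= eqxx mulr1 RRe_real.
    by rewrite andbT [a == i]eq_sym; case: eqP => [->|_];
      rewrite ?mulr1 ?mulr1n ?mulr0 ?mul0r ?mulr0n ?mul1r.
  by have /mxOverP := hermitian_spectral_diag_real hA.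
by move=> j ji; rewrite !mxE (negPf ji)/= mulr0.
Qed.

Lemma parseval A u v :
  dotc u v = \sum_i dotc u (eigvec A i) * dotc (eigvec A i) v.
Proof.
rewrite {1}/dotc -[u^t*]mulmx1 -(eigvec_complete A) mulmx_sumr mulmx_suml summxE.
apply: eq_bigr => i _.
by rewrite !mulmxA -mulmxA mxE big_ord1.
Qed.

Lemma parseval_normsq A v : normsq v = \sum_i abs2 (dotc (eigvec A i) v).
Proof.
apply: complexI; rewrite -dotc_normsq (parseval A) rmorph_sum.
by apply: eq_bigr => i _; rewrite dotcC mulcJ_abs2.
Qed.

Lemma normsq_eigvec A i : normsq (eigvec A i) = 1.
Proof. by apply: complexI; rewrite -dotc_normsq eigvec_ortho eqxx. Qed.

Lemma dotc_eigvec A i v : A \is hermsymmx ->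
  dotc (eigvec A i) (A *m v) = (eigval A i)%:C * dotc (eigvec A i) v.
Proof.
move=> hA; rewrite dotc_herm// eigvec_eq// dotcC dotcZr rmorphM /= -dotcC.
by rewrite conjC_real.
Qed.

Lemma qform_eigvec A i : A \is hermsymmx -> qform A (eigvec A i) = eigval A i.
Proof.
by move=> hA; rewrite /qform dotc_eigvec// eigvec_ortho eqxx mulr1.
Qed.

Lemma eigval_bound A i : A \is hermsymmx -> `|eigval A i| <= ent1norm A.
Proof.
by move=> hA; rewrite -qform_eigvec// qform_bound// normsq_eigvec.
Qed.

Lemma mxtrace_eigvec A C : \tr C = \sum_i dotc (eigvec A i) (C *m eigvec A i).
Proof.
rewrite -[C in LHS]mulmx1 -(eigvec_complete A) mulmx_sumr raddf_sum /=.
by apply: eq_bigr => i _; rewrite mulmxA mxtrace_mulC /mxtrace big_ord1.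
Qed.

(* Re tr (C f(A)), with f(A) given by the functional calculus of A. *)
Definition trfun (f : R -> R) C A : R :=
  \sum_i f (eigval A i) * qform C (eigvec A i).

Lemma trfunD f B C A : trfun f (B + C) A = trfun f B A + trfun f C A.
Proof. by rewrite -big_split; apply: eq_bigr => i _; rewrite qformD mulrDr. Qed.

Lemma trfunN f C A : trfun f (- C) A = - trfun f C A.
Proof. by rewrite -sumrN; apply: eq_bigr => i _; rewrite qformN mulrN. Qed.

Lemma trfun_sum (I : Type) (s : seq I) (p : pred I) (F : I -> 'M[R[i]]_d) f A :
  trfun f (\sum_(i <- s | p i) F i) A = \sum_(i <- s | p i) trfun f (F i) A.
Proof.
rewrite /trfun exchange_big; apply: eq_bigr => i _.
by rewrite qform_sum mulr_sumr.
Qed.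

Lemma trfun_loewner f B C A : (forall x, 0 <= f x) -> loewner_le B C ->
  trfun f B A <= trfun f C A.
Proof.
by move=> f0 BC; apply: ler_sum => i _; rewrite ler_wpM2l// qform_loewner.
Qed.

Lemma trfun_bound f C A M : (forall i, `|f (eigval A i)| <= M) ->
  `|trfun f C A| <= d%:R * (M * ent1norm C).
Proof.
move=> fM; rewrite (le_trans (ler_norm_sum _ _ _))//.
have -> x : d%:R * x = \sum_(i < d) x by rewrite sumr_const card_ord mulr_natl.
by apply: ler_sum => i _; rewrite normrM ler_pM// qform_bound// normsq_eigvec.
Qed.

Lemma trfun_id f A : trfun f 1%:M A = \sum_i f (eigval A i).
Proof.
apply: eq_bigr => i _.
by rewrite /qform mul1mx dotc_normsq normsq_eigvec mulr1.
Qed.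

Lemma trfun_self f A : A \is hermsymmx ->
  trfun f A A = \sum_i f (eigval A i) * eigval A i.
Proof. by move=> hA; apply: eq_bigr => i _; rewrite qform_eigvec. Qed.

(* Expanding both traces over the pairs of eigenvectors (u_i of A, v_j of B)
   turns the left side into a double sum of
   (f(a_i) - f(b_j)) <v_j, u_i> <v_j, C u_i>, and (a_i - b_j) <v_j, u_i> is
   the matrix element <v_j, (A - B) u_i>. *)
Lemma trfun_mean_value f A B C (L : R) :
    A \is hermsymmx -> B \is hermsymmx -> C \is hermsymmx -> 0 <= L ->
    (forall x, 0 <= f x) ->
    (forall x y, `|f x - f y| <= L * `|x - y| * (f x + f y)) ->
  trfun f C A - trfun f C B <=
  L / 2 * (trfun f ((A - B) ^+ 2) A + trfun f (C ^+ 2) A +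
           trfun f ((A - B) ^+ 2) B + trfun f (C ^+ 2) B).
Proof.
move=> hA hB hC L0 f0 fL.
pose u := eigvec A; pose v := eigvec B; pose a := eigval A; pose b := eigval B.
have hAB : A - B \is hermsymmx.
  by apply: hermI; rewrite linearB/= map_mxB !hermP.
pose p i j := complex.Re (dotc (u i) (v j) * dotc (v j) (C *m u i)).
have trA : trfun f C A = \sum_i \sum_j f (a i) * p i j.
  apply: eq_bigr => i _.
  by rewrite -mulr_sumr /qform (parseval B) Re_sum.
(* Expansion in the basis of [A] gives the conjugate of the product in [p], as [C] is Hermitian; the
   real part is the same. *)
have trB : trfun f C B = \sum_i \sum_j f (b j) * p i j.
  rewrite exchange_big; apply: eq_bigr => j _.
  rewrite -mulr_sumr /qform (parseval A) Re_sum; congr (_ * _).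
  apply: eq_bigr => i _.
  rewrite dotcC [dotc (eigvec A i) (C *m _)]dotcC -dotc_herm// -rmorphM /=.
  by rewrite conjC_ReIm.
pose q i j := abs2 (dotc (v j) ((A - B) *m u i)).
pose r i j := abs2 (dotc (v j) (C *m u i)).
have qE i j : q i j = (a i - b j) ^+ 2 * abs2 (dotc (u i) (v j)).
  rewrite /q mulmxBl dotcBr eigvec_eq// dotcZr dotc_eigvec// -mulrBl abs2M.
  congr (_ * _); last by rewrite dotcC abs2_conj.
  by rewrite /abs2 -rmorphB /= expr0n addr0.
have sqA (D : 'M[R[i]]_d) : D \is hermsymmx ->
    trfun f (D ^+ 2) A = \sum_i \sum_j f (a i) * abs2 (dotc (v j) (D *m u i)).
  move=> hD; apply: eq_bigr => i _.
  by rewrite -mulr_sumr qform_sqr// (parseval_normsq B).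
have sqB (D : 'M[R[i]]_d) : D \is hermsymmx ->
    trfun f (D ^+ 2) B = \sum_i \sum_j f (b j) * abs2 (dotc (v j) (D *m u i)).
  move=> hD; rewrite exchange_big; apply: eq_bigr => j _.
  rewrite -mulr_sumr qform_sqr// (parseval_normsq A); congr (_ * _).
  by apply: eq_bigr => i _; rewrite dotcC dotc_herm// abs2_conj.
rewrite trA trB !sqA// !sqB// -!big_split/= -sumrB mulr_sumr.
apply: ler_sum => i _; rewrite -!big_split/= -sumrB mulr_sumr.
apply: ler_sum => j _; rewrite -mulrBl -!/(q i j) -!/(r i j).
have -> : f (a i) * q i j + f (a i) * r i j + f (b j) * q i j + f (b j) * r i j
  = (f (a i) + f (b j)) * (q i j + r i j) by ring.
have f2 : 0 <= f (a i) + f (b j) by rewrite addr_ge0.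
(* The sign of the product is unknown, so Young's inequality is used with weight a_i - b_j or its
   opposite; [q] sees only the square. *)
have young : `|a i - b j| * `|p i j| <= (q i j + r i j) / 2.
  rewrite -normrM; have [p0|p0] := leP 0 ((a i - b j) * p i j).
    by rewrite ger0_norm// qE; exact: Re_mul_le.
  rewrite ltr0_norm//.
  by rewrite qE -sqrrN -mulNr; exact: Re_mul_le.
rewrite (le_trans (ler_norm _))// normrM.
apply: (@le_trans _ _ (L * `|a i - b j| * (f (a i) + f (b j)) * `|p i j|)).
  by rewrite ler_wpM2r.
have -> : L * `|a i - b j| * (f (a i) + f (b j)) * `|p i j| =
   L * (f (a i) + f (b j)) * (`|a i - b j| * `|p i j|) by ring.
have -> : L / 2 * ((f (a i) + f (b j)) * (q i j + r i j)) =
   L * (f (a i) + f (b j)) * ((q i j + r i j) / 2) by field.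
by rewrite ler_wpM2l// mulr_ge0.
Qed.

End Eigenbasis.

(** * Scalar inequalities for the exponential *)

Section Exponential.
Context {R : realType}.
Implicit Types (x y th : R).

Lemma expR_sub_le x y : expR x - expR y <= (x - y) * expR x.
Proof.
have /(ler_wpM2l (expR_ge0 x)) := expR_ge1Dx (y - x).
by rewrite -expRD mulrDr mulr1 [x + _]addrC subrK; lra.
Qed.

(** The tangent bound at the larger argument, with the other exponential added for symmetry.
    Convexity would even allow a factor 1/2; the present form is what leads to the exponent th^2
    sigma^2 / 2. *)
Lemma expR_lipschitz th x y : 0 <= th ->
  `|expR (th * x) - expR (th * y)| <=
  th * `|x - y| * (expR (th * x) + expR (th * y)).
Proof.
move=> th0.
wlog yx : x y / y <= x.
  by move=> h; have [/h//|/ltW/h] := leP y x; rewrite distrC [ `|y - x| ]distrC [expR _ + _]addrC.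
rewrite !ger0_norm ?subr_ge0 ?ler_expR ?ler_wpM2l//.
rewrite (le_trans (expR_sub_le _ _))// -mulrBr ler_wpM2l ?lerDl ?expR_ge0//.
by rewrite mulr_ge0 ?subr_ge0.
Qed.

End Exponential.

(** * Top eigenvalue, spectral norm and trace exponential *)

Section SpectralBounds.
Context {R : realType} {d : nat}.
Implicit Types (A B C D : 'M[R[i]]_d) (u v w : 'cV[R[i]]_d).

Lemma normsq_eq0 v : normsq v = 0 -> v = 0.
Proof.
move=> /eqP; rewrite psumr_eq0 => [|i _]; last exact: abs2_ge0.
move=> /allP h; apply/matrixP => i j; rewrite ord1 mxE.
have /eqP := h i (mem_index_enum i); rewrite /abs2 => /eqP.
rewrite paddr_eq0 ?sqr_ge0// !sqrf_eq0 => /andP[/eqP re /eqP im].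
by rewrite [LHS]complexE re im mulr0 addr0.
Qed.

(** [eigenvalue] refers to row vectors, hence the adjoints. A nonzero eigenvector has a nonzero
    coefficient on some [eigvec A i], and comparing that coefficient identifies its eigenvalue. *)
Lemma eigenvalueE A (x : R) : A \is hermsymmx ->
  reflect (exists i, x = eigval A i) (eigenvalue A x%:C).
Proof.
move=> hA; apply: (iffP eigenvalueP) => [[v vA v0]|[i ->]].
  pose w := v^t*.
  have Aw : A *m w = x%:C *: w.
    by rewrite -{1}(hermP hA) -map_mxM -trmx_mul vA linearZ/= map_mxZ/= conjC_real.
  have [[i wi]|h] := pselect (exists i, dotc (eigvec A i) w != 0); last first.
    case/eqP: v0; rewrite -[v]trmxCK -/w (@normsq_eq0 w) ?trmx0 ?map_mx0//.
    rewrite (parseval_normsq A) big1// => i _.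
    have /eqP -> : dotc (eigvec A i) w == 0 by apply: contra_notT h => wi; exists i.
    by rewrite /abs2 /= expr0n addr0.
  exists i; apply: complexI; apply: (mulIf wi).
  by rewrite -dotc_eigvec// Aw dotcZr.
exists ((eigvec A i)^t*); last first.
  apply/eqP => u0'; have u0 : eigvec A i = 0.
    by rewrite -[eigvec A i]trmxCK u0' trmx0 map_mx0.
  have := normsq_eigvec A i; rewrite u0 /normsq big1 => [/esym/eqP|j _].
    by rewrite oner_eq0.
  by rewrite mxE /abs2 /= expr0n addr0.
rewrite -[X in _ *m X](hermP hA) -map_mxM -trmx_mul eigvec_eq//.
by rewrite linearZ/= map_mxZ/= conjC_real.
Qed.

Lemma lambda_max_attained A : (0 < d)%N -> A \is hermsymmx ->
  (exists i, lambda_max A = eigval A i) /\ forall i, eigval A i <= lambda_max A.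
Proof.
move=> d0 hA.
have [i0 h] : exists i0, forall i, eigval A i <= eigval A i0.
  exists [arg max_(i > Ordinal d0) eigval A i]%O.
  by case: arg_maxP => // i _ h j; exact: h.
suff -> : lambda_max A = eigval A i0 by split; [exists i0|].
have ub : ubound [set x : R | eigenvalue A x%:C] (eigval A i0).
  by move=> x /(eigenvalueE _ hA)[i ->].
have mem : [set x : R | eigenvalue A x%:C] (eigval A i0).
  by apply/(eigenvalueE _ hA); exists i0.
apply/le_anti/andP; split; first by apply: ge_sup => //; exists (eigval A i0).
by apply: ub_le_sup => //; exists (eigval A i0).
Qed.

Definition trexp (th : R) C A : R := trfun (fun x => expR (th * x)) C A.

Lemma expR_lambda_max_le th A : (0 < d)%N -> A \is hermsymmx ->
  expR (th * lambda_max A) <= trexp th 1%:M A.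
Proof.
move=> d0 hA; have [[i ->] _] := lambda_max_attained d0 hA.
rewrite /trexp trfun_id (bigD1 i)//= lerDl.
by apply: sumr_ge0 => j _; exact: expR_ge0.
Qed.

Lemma trexp_le_lambda_max th A : (0 < d)%N -> 0 <= th -> A \is hermsymmx ->
  trexp th 1%:M A <= d%:R * expR (th * lambda_max A).
Proof.
move=> d0 th0 hA; have [_ h] := lambda_max_attained d0 hA.
have -> x : d%:R * x = \sum_(i < d) x :> R by rewrite sumr_const card_ord mulr_natl.
by rewrite /trexp trfun_id; apply: ler_sum => i _; rewrite ler_expR ler_wpM2l.
Qed.

(** The trace of e^{m A} lies between e^{m lambda} and d e^{m lambda}, with lambda the top
    eigenvalue and m = k + 1, so the error is at most ln d / m. The purpose is the measurability of
    [lambda_max]. *)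
Lemma lambda_max_cvg A : (0 < d)%N -> A \is hermsymmx ->
  (fun k => k.+1%:R^-1 * ln (trexp k.+1%:R 1%:M A)) @ \oo --> lambda_max A.
Proof.
move=> d0 hA.
have dR : 0 < d%:R :> R by rewrite ltr0n.
apply: (@squeeze_cvgr _ _ _ _ (fun=> lambda_max A)
   (fun k => lambda_max A + ln d%:R * k.+1%:R^-1)).
- near=> k; have k0 : 0 < k.+1%:R :> R by rewrite ltr0n.
  have lo := expR_lambda_max_le k.+1%:R d0 hA.
  have hi := trexp_le_lambda_max d0 (ltW k0) hA.
  have tr0 : 0 < trexp k.+1%:R 1%:M A by apply: lt_le_trans lo; exact: expR_gt0.
  rewrite mulrC ler_pdivlMr// ler_pdivrMr// mulrDl divfK ?gt_eqF//.
  rewrite -[leLHS]expRK mulrC ler_ln ?posrE ?expR_gt0// lo/=.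
  rewrite -[X in _ <= X + _]expRK addrC -lnM ?posrE ?expR_gt0//.
  by rewrite ler_ln ?posrE ?mulr_gt0 ?expR_gt0.
- exact: cvg_cst.
- rewrite -[X in _ --> X]addr0 -[X in _ + X](mulr0 (ln d%:R)).
  by apply: cvgD; [exact: cvg_cst|apply: cvgMl_tmp; exact: cvg_harmonic].
Unshelve. all: by end_near. Qed.

Lemma dotc_le u v : normsq u <= 1 -> complex.Re (dotc u v) <= Num.sqrt (normsq v).
Proof.
move=> u1; rewrite leNgt; apply/negP; set s := Num.sqrt _ => sc.
pose c := complex.Re (dotc u v); rewrite -/c in sc.
have s0 : 0 <= s by exact: sqrtr_ge0.
have sc2 : s ^+ 2 < c ^+ 2 by rewrite ltr_sqr ?nnegrE// ltW// (le_lt_trans s0).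
(* Young's inequality with weight [c], coordinate by coordinate; after summation it contradicts s <
   c. *)
suff : c ^+ 2 <= (c ^+ 2 + s ^+ 2) / 2 by lra.
rewrite expr2 {2}/c dotcE Re_sum mulr_sumr /s sqr_sqrtr ?normsq_ge0//.
apply: (@le_trans _ _ (\sum_i (c ^+ 2 * abs2 (u i 0) + abs2 (v i 0)) / 2)).
  by apply: ler_sum => i _; rewrite -(abs2_conj (u i 0)) Re_mul_le.
rewrite -mulr_suml big_split/= -mulr_sumr ler_wpM2r// lerD2r.
by rewrite -/(normsq u) -[leRHS]mulr1 ler_wpM2l// sqr_ge0.
Qed.

Lemma l2normE v : l2norm v = Num.sqrt (normsq v).
Proof. by congr Num.sqrt; apply: eq_bigr => i _; rewrite abs2_normc. Qed.

Lemma qform_specnorm A v : normsq v = 1 -> qform A v <= specnorm A.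
Proof.
move=> v1; rewrite /qform (le_trans (dotc_le _ _)) ?v1// -l2normE.
apply: ub_le_sup; last by exists v => //=; rewrite l2normE v1 sqrtr1.
(* A [sup] dominates its set only if the set is bounded: the squared norm of A w is the form of the
   adjoint of A times A at w. *)
exists (Num.sqrt (ent1norm (A^t* *m A))) => _ [w w1 <-].
rewrite l2normE ler_wsqrtr// (le_trans _ (@qform_bound _ _ _ w _))//; last first.
  by move: w1; rewrite /= l2normE -[X in _ <= X]sqrtr1 ler_sqrt.
by rewrite /qform -mulmxA dotc_mul_adj trmxCK dotc_normsq ler_norm.
Qed.

(** Intended for the whole sum of the A_k^2 as [C]: this is the point where sigma^2 appears. *)
Lemma trexp_specnorm th C A : trexp th C A <= specnorm C * trexp th 1%:M A.
Proof.
rewrite /trexp trfun_id mulr_sumr; apply: ler_sum => i _.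
by rewrite mulrC ler_wpM2r ?expR_ge0// qform_specnorm// normsq_eigvec.
Qed.

(** [A - B] is to be X - X^(k) and [C] the telescoping difference. Both squares are below the same
    [S], so the four traces merge in pairs and absorb the factor 1/2. *)
Lemma trexp_mean_value th A B C (S : 'M[R[i]]_d) :
    A \is hermsymmx -> B \is hermsymmx -> C \is hermsymmx -> 0 <= th ->
    loewner_le ((A - B) ^+ 2) S -> loewner_le (C ^+ 2) S ->
  trexp th C A - trexp th C B <= th * (trexp th S A + trexp th S B).
Proof.
move=> hA hB hC th0 ABS CS.
have e0 x : 0 <= expR (th * x) by exact: expR_ge0.
rewrite (le_trans (trfun_mean_value hA hB hC th0 e0 _))//.
  by move=> x y; exact: expR_lipschitz.
have h1 := trfun_loewner A e0 ABS.
have h2 := trfun_loewner A e0 CS.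
have h3 := trfun_loewner B e0 ABS.
have h4 := trfun_loewner B e0 CS.
rewrite -mulrA ler_wpM2l// /trexp; lra.
Qed.

(** The tangent inequality at [b] for th |-> e^{th x}, summed over the eigenvalues x. It replaces
    differentiation under the expectation by a finite difference. *)
Lemma trexp_convex a b A : A \is hermsymmx ->
  trexp b 1%:M A - trexp a 1%:M A <= (b - a) * trexp b A A.
Proof.
move=> hA; rewrite /trexp !trfun_id trfun_self// -sumrB mulr_sumr.
apply: ler_sum => i _; rewrite (le_trans (expR_sub_le _ _))// -mulrBl.
by rewrite -mulrA [eigval A i * _]mulrC.
Qed.

Lemma trexp_bound th C A : A \is hermsymmx -> 0 <= th ->
  `|trexp th C A| <= d%:R * (expR (th * ent1norm A) * ent1norm C).
Proof.
move=> hA th0; apply: trfun_bound => i.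
rewrite ger0_norm ?expR_ge0// ler_expR ler_wpM2l//.
by rewrite (le_trans (ler_norm _))// eigval_bound.
Qed.

(** The entry is a coordinate of D e_j, whose squared norm is the form of D^2 at e_j and hence at
    most that of [S]. *)
Lemma loewner_sqr_entry D S i j : D \is hermsymmx -> loewner_le (D ^+ 2) S ->
  abs2 (D i j) <= ent1norm S.
Proof.
move=> hD DS; pose e : 'cV[R[i]]_d := delta_mx j 0.
have e1 : normsq e <= 1.
  rewrite /normsq (bigD1 j)//= big1 => [|k kj]; rewrite !mxE ?eqxx ?(negPf kj)/=.
    by rewrite /abs2 /= expr1n expr0n !addr0.
  by rewrite /abs2 /= expr0n addr0.
rewrite (le_trans _ (le_trans (qform_loewner e DS) _))//; last first.
  by rewrite (le_trans (ler_norm _))// qform_bound.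
rewrite qform_sqr// /normsq (bigD1 i)//= -colE mxE lerDl.
by apply: sumr_ge0 => k _; exact: abs2_ge0.
Qed.

Lemma trfun_pow k C A : A \is hermsymmx ->
  trfun (fun x => x ^+ k) C A = complex.Re (\tr (C *m A ^+ k)).
Proof.
move=> hA; rewrite (mxtrace_eigvec A) Re_sum; apply: eq_bigr => i _.
have -> : C *m A ^+ k *m eigvec A i = (eigval A i ^+ k)%:C *: (C *m eigvec A i).
  rewrite -mulmxA scalemxAr; congr (_ *m _).
  elim: k => [|k IH]; first by rewrite !expr0 scale1r mul1mx.
  by rewrite exprS -mulmxA IH -scalemxAr eigvec_eq// scalerA -rmorphM exprSr.
by rewrite dotcZr ReZ.
Qed.

(** On each eigenvector this is the scalar exponential series. The partial sums are polynomials in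
    the entries of [A] and [C], whose measurability is plain. *)
Lemma trexp_cvg th C A : A \is hermsymmx ->
  (fun n => \sum_(0 <= k < n) th ^+ k / k`!%:R * complex.Re (\tr (C *m A ^+ k)))
    @ \oo --> trexp th C A.
Proof.
move=> hA.
have -> : (fun n => \sum_(0 <= k < n) th ^+ k / k`!%:R * complex.Re (\tr (C *m A ^+ k)))
  = (fun n => \sum_i series (exp_coeff (th * eigval A i)) n * qform C (eigvec A i)).
  apply/funext => n; rewrite /series /=.
  under [RHS]eq_bigr do rewrite mulr_suml.
  rewrite exchange_big; apply: eq_bigr => k _.
  rewrite -trfun_pow// mulr_sumr; apply: eq_bigr => i _.
  by rewrite /exp_coeff /= exprMn; ring.
apply: cvg_big => [|i _]; first exact: add_continuous.
apply: cvgM; last exact: cvg_cst.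
exact: is_cvg_series_exp_coeff.
Qed.

End SpectralBounds.

(** * Borel sets of a Polish product space *)

Section BorelProduct.
Context {R : realType}.

(* Second countability makes every open set a countable union of members of
   any family of neighbourhoods that is fine enough. *)
Lemma polish_measurable_preimage (Y : topologicalType) d (S : measurableType d)
    (phi : S -> Y) : polish R Y ->
  (forall (U : set Y) x, open U -> U x ->
     exists V, [/\ nbhs x V, V `<=` U & measurable (phi @^-1` V)]) ->
  forall U, open U -> measurable (phi @^-1` U).
Proof.
move=> [[D /countable_injP[f fI] dD] [dist [_ distC distT distN _]]] phiV.
move=> U oU.
pose C (am : nat * nat) : set (set Y) := [set V | exists q,
  [/\ D q, f q = am.1, [set y | dist q y < am.2.+1%:R^-1] `<=` V,
      V `<=` U & measurable (phi @^-1` V)]].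
(* One admissible set for each ball centred in the dense set, coded by the number of its centre and
   the index of its radius; a code without admissible set gives [set0], which adds nothing. *)
pose W am := xget set0 (C am).
have -> : phi @^-1` U = \bigcup_am phi @^-1` (W am).
  apply/seteqP; split=> [s Us|s [am _]]; last first.
    by rewrite /W /=; case: xgetP => // _ -> [q [_ _ _ sub _]] /sub.
  have [V [nV VU mV]] := phiV U (phi s) oU Us.
  have /(distN (phi s) V)[e e0 eV] := nV.
  (* A ball of radius r about a point at distance less than r stays within 2 r, whence the factor
     2. *)
  have [m me] : exists m : nat, 2 * m.+1%:R^-1 < e.
    have [m] := near_infty_natSinv_lt (PosNum (divr_gt0 e0 (ltr0Sn R 1))).
    by move=> _ /(_ m (leqnn m)) /= h; exists m; move: h; set u := _^-1; lra.
  set r := m.+1%:R^-1 in me.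
  have r0 : 0 < r :> R by rewrite invr_gt0.
  have nB : nbhs (phi s) [set y | dist (phi s) y < r].
    by apply/distN; exists r.
  have [q [/interior_subset /= sq Dq]] :
      ([set y | dist (phi s) y < r]^° `&` D) !=set0.
    by apply: dD; [exists (phi s)|exact: open_interior].
  have CV : C (f q, m) V.
    exists q; split => // y /= qy; apply: eV => /=.
    by rewrite (le_lt_trans (distT _ q _))// (lt_trans _ me)// mulr_natl mulr2n ltrD.
  exists (f q, m) => //;
  (* The set chosen for this code may come with another centre [q']; injectivity of [f] on [D]
     identifies the two. *)
  have [q' [Dq' fq' + _ _]] := @xgetPex _ set0 (C (f q, m)) (ex_intro _ V CV).
  apply => /=; have -> : q' = q by apply: fI; [exact/mem_set|exact/mem_set|exact: fq'].
  by rewrite distC.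
apply: countable_bigcupT_measurable => // am; rewrite /W.
by case: xgetP => [_ -> [q []]//|_]; rewrite preimage_set0.
Qed.

(** Coordinatewise measurability controls finite intersections of cylinders. These are fine enough
    as neighbourhoods, and the Polish property makes an open set a countable union of such sets. *)
Lemma measurable_prod_topology (I : eqType) (T : I -> ptopologicalType)
    d (S : measurableType d) (phi : S -> prod_topology T) :
  polish R (prod_topology T) ->
  (forall j, measurable_fun setT (fun s => phi s j : borel (T j))) ->
  measurable_fun setT (phi : S -> borel (prod_topology T)).
Proof.
move=> pT mphi.
have mE : @measurable _ (borel (prod_topology T)) = <<s @open (prod_topology T) >> by [].
move=> mS; apply: (measurability _ mE) => // _ [W oW <-]; rewrite setTI.
apply: (@polish_measurable_preimage (prod_topology T) d S phi pT) => // U x oU Ux.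
have [P [[Q QfinP <-] [V JV Vx] PU]] : nbhs x U by exact: open_nbhs_nbhs.
have [L Lsub VE] := QfinP _ JV.
have Lb (M : set (prod_topology T)) : [set` L] M ->
    exists j (N : set (T j)), open N /\ M = (fun z => z j) @^-1` N.
  by move=> /= /Lsub /set_mem[j _ [N oN <-]]; exists j, N.
exists V; split; last 1 first.
- rewrite -VE preimage_bigcap; apply: fin_bigcap_measurable; first exact: finite_fset.
  move=> M /Lb[j [N [oN ->]]]; rewrite -[X in measurable X]setTI.
  by apply: (mphi j) => //; exact: sub_sigma_algebra.
- rewrite -VE; apply: filter_bigI => M LM.
  have Mx : M x by move: Vx; rewrite -VE => /(_ _ LM).
  have [j [N [oN ME]]] := Lb _ LM; rewrite ME.
  apply: (@proj_continuous _ T j); apply: open_nbhs_nbhs; split => //.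
  by move: Mx; rewrite ME.
- by move=> y Vy; apply: PU; exists V.
Qed.

Lemma measurable_proj (I : eqType) (T : I -> ptopologicalType) j :
  measurable_fun setT
    ((fun z => z j) : borel (prod_topology T) -> borel (T j)).
Proof.
have mE : @measurable _ (borel (T j)) = <<s @open (T j) >> by [].
move=> mS; apply: (measurability _ mE) => // _ [U oU <-]; rewrite setTI.
apply: sub_sigma_algebra.
have /continuousP h : continuous (fun z : prod_topology T => (z j : T j)).
  exact: (@proj_continuous _ T j).
exact: h.
Qed.

End BorelProduct.

(** * Bounded integrands and equality in law *)

Lemma bounded_integrable {R : realType} d (S : measurableType d)
    (Q : probability S R) (f : S -> R) (M : R) :
  measurable_fun setT f -> (forall s, `|f s| <= M) ->
  Q.-integrable setT (EFin \o f).
Proof.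
move=> mf fM; apply: measurable_bounded_integrable => //.
  by change (Q setT < +oo)%E; rewrite probability_setT ltry.
exists M; split; first exact: num_real.
by move=> x Mx w _; apply: (le_trans (fM w)); exact: ltW.
Qed.

(** Both sides integrate [G] against the same image measure. Bounds are asked along [phi] and [psi]
    only, since the intended [G] is controlled only at attained points. *)
Lemma eq_distribution_Rintegral {R : realType} d d' (S : measurableType d)
    (S' : measurableType d') (Q : probability S R) (phi psi : S -> S') :
  measurable_fun setT phi -> measurable_fun setT psi ->
  (forall A, measurable A -> Q (phi @^-1` A) = Q (psi @^-1` A)) ->
  forall G : S' -> R, measurable_fun setT G ->
  (exists M : R, forall w, `|G (phi w)| <= M) ->
  (exists M : R, forall w, `|G (psi w)| <= M) ->
  \int[Q]_w G (phi w) = \int[Q]_w G (psi w).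
Proof.
move=> mphi mpsi eqQ G mG [M1 b1] [M2 b2].
have mE : measurable_fun setT (EFin \o G) by exact/measurable_EFinP.
have i1 : Q.-integrable setT (EFin \o (G \o phi)).
  by apply: bounded_integrable b1; exact: measurableT_comp.
have i2 : Q.-integrable setT (EFin \o (G \o psi)).
  by apply: bounded_integrable b2; exact: measurableT_comp.
congr fine.
rewrite -[LHS](@integral_pushforward _ _ _ _ _ phi mphi Q setT (EFin \o G))//.
rewrite -[RHS](@integral_pushforward _ _ _ _ _ psi mpsi Q setT (EFin \o G))//.
by apply: eq_measure_integral => A mA _; exact: eqQ.
Qed.

(** * Exchanging coordinates between two independent copies *)

Section Exchange.
Context {R : realType} {dO : measure_display} {Omega : measurableType dO}.
Context (P : probability Omega R) {n : nat} {T : 'I_n -> ptopologicalType}.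
Hypothesis polishT : polish R (prod_topology T).
Variable Z : forall j : 'I_n, {RV P >-> borel (T j)}.
Hypothesis indepZ : mutually_independent P (fun j => Z j : Omega -> borel (T j)).

Notation E := (borel (prod_topology T)).

Definition joint (w : Omega) : E := fun j => Z j w.

Definition select (J : {set 'I_n}) (x y : E) : E :=
  fun j => if j \in J then x j else y j.

Lemma measurable_joint : measurable_fun setT joint.
Proof.
apply: (measurable_prod_topology polishT).
by move=> j; exact: measurable_funPT.
Qed.

Lemma measurable_select d (S : measurableType d) (J : {set 'I_n}) (f g : S -> E) :
  measurable_fun setT f -> measurable_fun setT g ->
  measurable_fun setT (fun s => select J (f s) (g s)).
Proof.
move=> mf mg; apply: (measurable_prod_topology polishT) => j; rewrite /select.
by case: (j \in J); [exact: (measurableT_comp (@measurable_proj _ T j) mf)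
  |exact: (measurableT_comp (@measurable_proj _ T j) mg)].
Qed.

Definition pairbox (B C : forall j, set (borel (T j))) : set (E * E) :=
  [set x | forall j, B j (x.1 j) /\ C j (x.2 j)].

Definition pairboxes : set (set (E * E)) :=
  [set X | exists B C : forall j, set (borel (T j)),
    [/\ forall j, measurable (B j), forall j, measurable (C j) & X = pairbox B C]].

(** For the inclusion into the generated sigma-algebra it is enough that both projections be
    measurable for it, which is tested on coordinates: a condition on a single coordinate is itself
    a box. *)
Lemma measurable_pairboxes : @measurable _ (E * E)%type = <<s pairboxes >>.
Proof.
apply/seteqP; split; last first.
  apply: smallest_sub; first exact: sigma_algebra_measurable.
  move=> _ [B [C [mB mC ->]]].
  have -> : pairbox B C = \bigcap_(j in [set: 'I_n])
      ((fun x : E * E => x.1 j) @^-1` B j `&` (fun x : E * E => x.2 j) @^-1` C j).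
    by apply/seteqP; split => x h j; [move=> _; exact: h|exact: (h j I)].
  apply: fin_bigcap_measurable => // j _; apply: measurableI; rewrite -[X in measurable X]setTI.
    exact: (measurableT_comp (@measurable_proj _ T j) measurable_fst).
  exact: (measurableT_comp (@measurable_proj _ T j) measurable_snd).
pose S := g_sigma_algebraType pairboxes.
have gen j (D : set (borel (T j))) (b : bool) : measurable D ->
    pairboxes [set x : E * E | D ((if b then x.1 else x.2) j)].
  move=> mD.
  (* [D] at coordinate [j] and [setT] elsewhere; the type of the set depends on the coordinate, so
     [D] is transported along k = j. *)
  pose D' := fun k => if k =P j is ReflectT e then
    eq_rect_r (fun k => set (borel (T k))) D e else setT.
  have mD' k : measurable (D' k).
    by rewrite /D'; case: eqP => // e; subst k.
  have D'j : D' j = D.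
    by rewrite /D'; case: eqP => // e; rewrite (eq_irrelevance e erefl).
  have D'k k : k <> j -> D' k = setT.
    by rewrite /D'; case: eqP.
  case: b.
    exists D', (fun=> setT); split => //; apply/seteqP; split => x h.
      move=> k; split => //; have [->|/eqP kj] := eqVneq k j; first by rewrite D'j.
      by rewrite D'k.
    by have [+ _] := h j; rewrite D'j.
  exists (fun=> setT), D'; split => //; apply/seteqP; split => x h.
    move=> k; split => //; have [->|/eqP kj] := eqVneq k j; first by rewrite D'j.
    by rewrite D'k.
  by have [_ +] := h j; rewrite D'j.
have m1 : measurable_fun setT (fst : S -> E).
  apply: (measurable_prod_topology polishT) => j _ D mD; rewrite setTI.
  by apply: sub_sigma_algebra; exact: (gen j D true).
have m2 : measurable_fun setT (snd : S -> E).
  apply: (measurable_prod_topology polishT) => j _ D mD; rewrite setTI.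
  by apply: sub_sigma_algebra; exact: (gen j D false).
rewrite measurable_prod_measurableType; apply: smallest_sub.
  exact: (@sigma_algebra_measurable _ S).
move=> _ [A mA [B mB <-]].
have -> : A `*` B = fst @^-1` A `&` snd @^-1` B by [].
by apply: (@measurableI _ S); rewrite -[X in measurable X]setTI; [exact: m1|exact: m2].
Qed.

Lemma setI_closed_pairboxes : setI_closed pairboxes.
Proof.
move=> _ _ [B [C [mB mC ->]]] [B' [C' [mB' mC' ->]]].
exists (fun j => B j `&` B' j), (fun j => C j `&` C' j); split.
- by move=> j; exact: measurableI.
- by move=> j; exact: measurableI.
- by apply/seteqP; split => x; [move=> [h h'] j|move=> h; split=> j];
    have := h j; [have := h' j|..]; move=> /=; tauto.
Qed.

Lemma prob_joint_box (B : forall j, set (borel (T j))) :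
  (forall j, measurable (B j)) ->
  P [set w | forall j, B j (joint w j)] = (\prod_j P (Z j @^-1` B j))%E.
Proof.
move=> mB; have := indepZ [set: 'I_n]%SET mB.
rewrite (eq_bigl xpredT) => [<-|j]; last by rewrite inE.
by congr (P _); apply/seteqP; split => w h j //=; apply: h; rewrite /= inE.
Qed.

Definition pair_swap (J : {set 'I_n}) (x : E * E) : E * E :=
  (select J x.2 x.1, select J x.1 x.2).

Definition joint2 (w : Omega * Omega) : E * E := (joint w.1, joint w.2).

Lemma measurable_pair_swap J : measurable_fun setT (pair_swap J).
Proof.
by apply: measurable_fun_pair; apply: measurable_select.
Qed.

Lemma measurable_joint2 : measurable_fun setT joint2.
Proof.
by apply: measurable_fun_pair; apply: (measurableT_comp measurable_joint).
Qed.

Lemma prob_joint2_box (B C : forall j, set (borel (T j))) :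
  (forall j, measurable (B j)) -> (forall j, measurable (C j)) ->
  (P \x P)%E (joint2 @^-1` pairbox B C) =
  (\prod_j (P (Z j @^-1` B j) * P (Z j @^-1` C j)))%E.
Proof.
move=> mB mC; rewrite big_split/= -!prob_joint_box//.
have mbox (D : forall j, set (borel (T j))) : (forall j, measurable (D j)) ->
    measurable [set w | forall j, D j (joint w j)].
  move=> mD; have -> : [set w | forall j, D j (joint w j)] =
      \bigcap_(j in [set: 'I_n]) (Z j @^-1` D j).
    by apply/seteqP; split => x h j; [move=> _; exact: h|exact: (h j I)].
  by apply: fin_bigcap_measurable => // j _;
    rewrite -[X in measurable X]setTI; exact: measurable_funPT.
rewrite -product_measure1E; [|exact: mbox|exact: mbox].
congr ((P \x P)%E _); apply/seteqP; split => -[w w'] /=.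
  by move=> h; split => j; have [] := h j.
by move=> [h h'] j; split; [exact: h|exact: h'].
Qed.

(** Boxes are closed under intersection and generate, so the two image measures need only agree on
    them. The exchange trades [B j] for [C j] when j is in [J], and the probability of a box is a
    product over j of factors symmetric in the two. *)
Lemma joint2_exchange J (A : set (E * E)) : measurable A ->
  (P \x P)%E (joint2 @^-1` A) = (P \x P)%E ((pair_swap J \o joint2) @^-1` A).
Proof.
have mswap : measurable_fun setT (pair_swap J \o joint2).
  by apply: measurableT_comp; [exact: measurable_pair_swap|exact: measurable_joint2].
pose m1 := pushforward (P \x P)%E joint2.
pose m2 := pushforward (P \x P)%E (pair_swap J \o joint2).
move=> mA.
have mset : pairboxes setT.
  by exists (fun=> setT), (fun=> setT); split => //; apply/seteqP; split.
apply: (@measure_unique _ R (E * E)%type pairboxes (fun=> setT) measurable_pairboxes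
  setI_closed_pairboxes _ _ m1 m2 _ _ A mA) => //.
- by rewrite bigcup_const.
- exact: measurable_joint2.
- move=> m1M _ [B [C [mB mC ->]]].
  change ((P \x P)%E (joint2 @^-1` pairbox B C) =
    (P \x P)%E (joint2 @^-1` (pair_swap J @^-1` pairbox B C))).
  pose B' j := if j \in J then C j else B j.
  pose C' j := if j \in J then B j else C j.
  have -> : pair_swap J @^-1` pairbox B C = pairbox B' C'.
    apply/seteqP; split => x h j; have := h j; rewrite /= /select /B' /C';
      by case: (j \in J) => -[].
  rewrite !prob_joint2_box//; first last.
  - by move=> j; rewrite /C'; case: ifP.
  - by move=> j; rewrite /B'; case: ifP.
  apply: eq_bigr => j _; rewrite /B' /C'; case: ifP => // _.
  by rewrite muleC.
- by move=> m1M _; change ((P \x P)%E setT < +oo)%E; rewrite probability_setT ltry.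
Qed.

Lemma Rintegral_exchange J (G : E * E -> R) :
  measurable_fun setT G -> (exists M : R, forall w, `|G (joint2 w)| <= M) ->
  (exists M : R, forall w, `|G (pair_swap J (joint2 w))| <= M) ->
  \int[(P \x P)%E]_w G (joint2 w) = \int[(P \x P)%E]_w G (pair_swap J (joint2 w)).
Proof.
move=> mG b1 b2; apply: (@eq_distribution_Rintegral _ _ _ _ _ (P \x P)%E
  joint2 (pair_swap J \o joint2) _ _ _ G mG b1 b2).
- exact: measurable_joint2.
- by apply: measurableT_comp; [exact: measurable_pair_swap|exact: measurable_joint2].
- by move=> A; exact: joint2_exchange.
Qed.

End Exchange.

(** * A discrete Gronwall inequality *)

Section Gronwall.
Context {R : realType}.

(** The exponent exceeds x only to second order, so over N steps of size O(1/N) the total excess is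
    O(1/N). *)
Lemma one_sub_expR (x : R) : 0 <= x <= 1 / 2 -> 1 <= (1 - x) * expR (x + 2 * x ^+ 2).
Proof.
move=> /andP[x0 x1].
have h := expR_ge1Dx (x + 2 * x ^+ 2).
rewrite (@le_trans _ _ ((1 - x) * (1 + (x + 2 * x ^+ 2))))//; last first.
  by rewrite ler_wpM2l//; lra.
rewrite -subr_ge0.
have -> : (1 - x) * (1 + (x + 2 * x ^+ 2)) - 1 = x ^+ 2 * (1 - 2 * x) by ring.
by rewrite mulr_ge0 ?sqr_ge0//; lra.
Qed.

(* The hypothesis on g is the backward Euler form of g'(b) <= b s g(b). *)
Lemma gronwall_sqr (g : R -> R) (s : R) : 0 <= s -> (forall x, 0 <= g x) ->
  (forall a b, 0 <= a -> a <= b -> g b * (1 - (b - a) * b * s) <= g a) ->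
  forall th, 0 <= th -> g th <= g 0 * expR (th ^+ 2 * s / 2).
Proof.
move=> s0 g0 gab th th0; set c := th ^+ 2 * s.
have c0 : 0 <= c by rewrite mulr_ge0 ?sqr_ge0.
(* [K] gathers what vanishes with the mesh: c / 2 because the steps sum to M (M + 1) / 2 and not M^2
   / 2, and 2 c^2 from the quadratic excess. *)
pose K := c / 2 + 2 * c ^+ 2.
have step (N : nat) : 2 * c <= N.+1%:R ->
    g th <= g 0 * expR (c / 2 + K * N.+1%:R^-1).
  move=> Nc; set M : R := N.+1%:R; have M0 : 0 < M by rewrite ltr0n.
  pose h := th / M; have h0 : 0 <= h by rewrite divr_ge0// ltW.
  (* The step ending at grid point k h costs a factor 1 / (1 - x) with x = h^2 k s. These x add up
     to h^2 s k (k + 1) / 2, and each is at most c / M, hence at most 1/2. *)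
  have ind (k : nat) : (k <= N.+1)%N -> g (k%:R * h) <=
      g 0 * expR (h ^+ 2 * s * (k%:R * (k%:R + 1) / 2) + k%:R * (2 * (c / M) ^+ 2)).
    elim: k => [_|k IH kN]; first by rewrite !mul0r mulr0 addr0 expR0 mulr1.
    have {}IH := IH (ltnW kN).
    set k1 : R := k.+1%:R; have k1E : k1 = k%:R + 1 by rewrite /k1 -natr1.
    have k10 : 0 <= k1 by rewrite ler0n.
    have k1M : k1 <= M by rewrite ler_nat.
    pose x := h ^+ 2 * k1 * s.
    have hM : h * M = th by rewrite /h divfK// gt_eqF.
    have cM : c / M = h ^+ 2 * M * s by rewrite /c -hM; field; rewrite gt_eqF.
    have x0 : 0 <= x by exact: mulr_ge0 (mulr_ge0 (sqr_ge0 h) k10) s0.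
    have xc : x <= c / M.
      by rewrite cM /x ler_wpM2r// ler_wpM2l// sqr_ge0.
    have x12 : x <= 1 / 2.
      rewrite (le_trans xc)// ler_pdivrMr//; move: Nc; rewrite -/M => Nc; lra.
    have hstep : g (k1 * h) * (1 - x) <= g (k%:R * h).
      have := @gab (k%:R * h) (k1 * h).
      have -> : (k1 * h - k%:R * h) * (k1 * h) * s = x by rewrite /x k1E; ring.
      apply; first by rewrite mulr_ge0.
      by rewrite ler_wpM2r// k1E lerDl.
    have e1 : 1 <= (1 - x) * expR (x + 2 * x ^+ 2) by rewrite one_sub_expR// x0.
    rewrite (@le_trans _ _ (g (k1 * h) * ((1 - x) * expR (x + 2 * x ^+ 2))))//.
      by rewrite ler_peMr.
    rewrite (@le_trans _ _ (g (k%:R * h) * expR (x + 2 * x ^+ 2)))//.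
      by rewrite mulrA ler_wpM2r// expR_ge0.
    rewrite (le_trans (ler_wpM2r (expR_ge0 _) IH))//.
    rewrite -(mulrA (g 0)) -expRD ler_wpM2l// ler_expR.
    have x2 : x ^+ 2 <= (c / M) ^+ 2 by rewrite lerXn2r// nnegrE// divr_ge0// ltW.
    rewrite -subr_ge0.
    have -> : h ^+ 2 * s * (k1 * (k1 + 1) / 2) + k1 * (2 * (c / M) ^+ 2) -
      (h ^+ 2 * s * (k%:R * (k%:R + 1) / 2) + k%:R * (2 * (c / M) ^+ 2) +
       (x + 2 * x ^+ 2)) = 2 * ((c / M) ^+ 2 - x ^+ 2).
      by rewrite /x k1E; field; rewrite gt_eqF.
    by rewrite mulr_ge0// subr_ge0.
  have := ind N.+1 (leqnn _); rewrite -/M.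
  have -> : M * h = th by rewrite /h mulrC divfK// gt_eqF.
  move/le_trans; apply; rewrite ler_wpM2l// ler_expR /K /h /c.
  by rewrite le_eqVlt; apply/orP; left; apply/eqP; field; rewrite gt_eqF.
have lim : (fun N => g 0 * expR (c / 2 + K * N.+1%:R^-1)) @ \oo --> g 0 * expR (c / 2).
  apply: cvgMl_tmp; apply: continuous_cvg; first exact: continuous_expR.
  rewrite -[X in _ --> X]addr0 -[X in _ + X](mulr0 K).
  by apply: cvgD; [exact: cvg_cst|apply: cvgMl_tmp; exact: cvg_harmonic].
rewrite -(cvg_lim _ lim)//; apply: limr_ge; first by apply/cvg_ex; eexists; exact: lim.
near=> N; apply: step; rewrite (@le_trans _ _ N%:R)// ?ler_nat//.
by near: N; exact: nbhs_infty_ger.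
Unshelve. all: by end_near. Qed.

End Gronwall.

(** * Expectation of bounded measurable functions *)

Section BoundedExpectation.
Context {R : realType} {d : measure_display} {S : measurableType d}.
Variable Q : probability S R.
Implicit Types f g : S -> R.

Definition bounded_measurable f : Prop :=
  measurable_fun setT f /\ exists M : R, forall s, `|f s| <= M.

Lemma bounded_measurable_integrable f :
  bounded_measurable f -> Q.-integrable setT (EFin \o f).
Proof. by move=> [mf [M fM]]; exact: bounded_integrable fM. Qed.

Lemma bounded_measurableD f g : bounded_measurable f -> bounded_measurable g ->
  bounded_measurable (fun s => f s + g s).
Proof.
move=> [mf [M fM]] [mg [N gN]]; split; first exact: measurable_funD.
by exists (M + N) => s; rewrite (le_trans (ler_normD _ _))// lerD.
Qed.

Lemma bounded_measurableZ (r : R) f : bounded_measurable f ->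
  bounded_measurable (fun s => r * f s).
Proof.
move=> [mf [M fM]]; split; first exact: measurable_funM.
by exists (`|r| * M) => s; rewrite normrM ler_wpM2l.
Qed.

Lemma bounded_measurableN f : bounded_measurable f ->
  bounded_measurable (fun s => - f s).
Proof.
move=> [mf [M fM]]; split; first exact: measurableT_comp.
by exists M => s; rewrite normrN.
Qed.

Lemma bounded_measurable_cst (r : R) : bounded_measurable (fun=> r).
Proof. by split => //; exists `|r|. Qed.

Lemma bounded_measurable_sum (I : Type) (s : seq I) (f : I -> S -> R) :
  (forall i, bounded_measurable (f i)) ->
  bounded_measurable (fun x => \sum_(i <- s) f i x).
Proof.
move=> bf; elim: s => [|i s IH].
  by under eq_fun do rewrite big_nil; exact: bounded_measurable_cst.
by under eq_fun do rewrite big_cons; exact: bounded_measurableD.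
Qed.

Lemma RintegralDb f g : bounded_measurable f -> bounded_measurable g ->
  \int[Q]_s (f s + g s) = \int[Q]_s f s + \int[Q]_s g s.
Proof. by move=> bf bg; apply: RintegralD => //; exact: bounded_measurable_integrable. Qed.

Lemma RintegralZb (r : R) f : bounded_measurable f ->
  \int[Q]_s (r * f s) = r * \int[Q]_s f s.
Proof. by move=> bf; apply: RintegralZl => //; exact: bounded_measurable_integrable. Qed.

Lemma RintegralNb f : bounded_measurable f ->
  \int[Q]_s (- f s) = - \int[Q]_s f s.
Proof.
move=> bf; rewrite -mulN1r -RintegralZb//; apply: eq_Rintegral => s _.
by rewrite mulN1r.
Qed.

Lemma Rintegral_prob_cst (r : R) : \int[Q]_s r = r.
Proof.
by rewrite Rintegral_cst//; change (r * fine (Q setT) = r); rewrite probability_setT mulr1.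
Qed.

Lemma Rintegral_sumb (I : Type) (s : seq I) (f : I -> S -> R) :
  (forall i, bounded_measurable (f i)) ->
  \int[Q]_x (\sum_(i <- s) f i x) = \sum_(i <- s) \int[Q]_x f i x.
Proof.
move=> bf; elim: s => [|i s IH].
  by rewrite big_nil; under eq_Rintegral do rewrite big_nil; exact: Rintegral_prob_cst.
rewrite big_cons -IH -RintegralDb//; last exact: bounded_measurable_sum.
by apply: eq_Rintegral => x _; rewrite big_cons.
Qed.

Lemma le_Rintegralb f g : bounded_measurable f -> bounded_measurable g ->
  (forall s, f s <= g s) -> \int[Q]_s f s <= \int[Q]_s g s.
Proof.
by move=> bf bg fg; apply: le_Rintegral => //; exact: bounded_measurable_integrable.
Qed.

Lemma expectationEb f : bounded_measurable f -> ('E_Q[f] = (\int[Q]_s f s)%R%:E)%E.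
Proof.
move=> bf; rewrite unlock /Rintegral fineK//.
by apply: integrable_fin_num => //; exact: bounded_measurable_integrable.
Qed.

End BoundedExpectation.

Lemma Rintegral_product {R : realType} d1 d2 (S1 : measurableType d1)
    (S2 : measurableType d2) (Q1 : probability S1 R) (Q2 : probability S2 R)
    (f : S1 * S2 -> R) : bounded_measurable f ->
  \int[(Q1 \x Q2)%E]_z f z = \int[Q1]_x \int[Q2]_y f (x, y).
Proof.
move=> bf; have fint := bounded_measurable_integrable (Q1 \x Q2)%E bf.
rewrite /Rintegral -(integral12_prod_meas1 fint); congr fine.
apply: eq_integral => x _; rewrite /fubini_F /= fineK//.
case: bf => mf [M fM]; apply: integrable_fin_num => //.
apply: (@bounded_measurable_integrable _ _ _ _ (fun y => f (x, y))); split.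
  exact: measurable_fun_pair2.
by exists M => y.
Qed.

(** * Measurability of matrix functions and of their spectral functionals *)

Section MatrixMeasurability.
Context {R : realType} {d : nat} {dS : measure_display} {S : measurableType dS}.
Implicit Types F G : S -> 'M[R[i]]_d.

Lemma mx_measurable_comp dS' (S' : measurableType dS') (phi : S -> S')
    (F : S' -> 'M[R[i]]_d) :
  mx_measurable F -> measurable_fun setT phi -> mx_measurable (fun s => F (phi s)).
Proof.
move=> mF mphi i k; have [mRe mIm] := mF i k.
by split; [exact: (measurableT_comp mRe mphi)|exact: (measurableT_comp mIm mphi)].
Qed.

Lemma mx_measurable_cst (A : 'M[R[i]]_d) : mx_measurable (fun _ : S => A).
Proof. by move=> i k; split; exact: measurable_cst. Qed.

Lemma mx_measurableB F G : mx_measurable F -> mx_measurable G ->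
  mx_measurable (fun s => F s - G s).
Proof.
move=> mF mG i k; have [mFr mFi] := mF i k; have [mGr mGi] := mG i k; split.
  under eq_fun do rewrite !mxE ReD ReN.
  exact: (measurable_funB mFr mGr).
under eq_fun do rewrite !mxE ImD ImN.
exact: (measurable_funB mFi mGi).
Qed.

Lemma mx_measurableM F G : mx_measurable F -> mx_measurable G ->
  mx_measurable (fun s => F s *m G s).
Proof.
move=> mF mG i k; split.
  under eq_fun do rewrite mxE Re_sum.
  apply: measurable_sum => j; under eq_fun do rewrite ReM.
  have [mFr mFi] := mF i j; have [mGr mGi] := mG j k.
  by apply: measurable_funB; exact: measurable_funM.
under eq_fun do rewrite mxE Im_sum.
apply: measurable_sum => j; under eq_fun do rewrite ImM.
have [mFr mFi] := mF i j; have [mGr mGi] := mG j k.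
by apply: measurable_funD; exact: measurable_funM.
Qed.

Lemma mx_measurableX F k : mx_measurable F -> mx_measurable (fun s => F s ^+ k).
Proof.
move=> mF; elim: k => [|k IH].
  by under eq_fun do rewrite expr0; exact: mx_measurable_cst.
under eq_fun do rewrite exprS.
exact: mx_measurableM.
Qed.

Lemma measurable_trexp th F G : mx_measurable F -> mx_measurable G ->
  (forall s, G s \is hermsymmx) -> measurable_fun setT (fun s => trexp th (F s) (G s)).
Proof.
move=> mF mG hG.
apply: (measurable_fun_cvg (h := fun n s => \sum_(0 <= k < n)
   th ^+ k / k`!%:R * complex.Re (\tr (F s *m G s ^+ k)))); last first.
  by move=> s _; exact: trexp_cvg.
move=> n; apply: measurable_sum => k; apply: measurable_funM => //.
under eq_fun do rewrite Re_sum.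
apply: measurable_sum => j.
by have [] := mx_measurableM mF (mx_measurableX k mG) j j.
Qed.

Lemma measurable_lambda_max G : (0 < d)%N -> mx_measurable G ->
  (forall s, G s \is hermsymmx) -> measurable_fun setT (fun s => lambda_max (G s)).
Proof.
move=> d0 mG hG.
apply: (measurable_fun_cvg
  (h := fun k s => k.+1%:R^-1 * ln (trexp k.+1%:R 1%:M (G s)))); last first.
  by move=> s _; exact: lambda_max_cvg.
move=> k; apply: measurable_funM => //.
apply: measurableT_comp; first exact: measurable_ln.
by apply: measurable_trexp => //; exact: mx_measurable_cst.
Qed.

End MatrixMeasurability.

(** * Entrywise expectation of bounded random matrices *)

Section MatrixExpectation.
Context {R : realType} {d : nat} {dS : measure_display} {S : measurableType dS}.
Variable Q : probability S R.
Implicit Types F : S -> 'M[R[i]]_d.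

Definition mx_bounded F : Prop := forall i k,
  bounded_measurable (fun s => complex.Re (F s i k)) /\
  bounded_measurable (fun s => complex.Im (F s i k)).

Lemma mx_bounded_ent1norm F : mx_bounded F -> exists M : R, forall s, ent1norm (F s) <= M.
Proof.
move=> bF.
have /choice[M HM] i : exists M : 'I_d -> R, forall k s,
    `|complex.Re (F s i k)| + `|complex.Im (F s i k)| <= M k.
  have /choice[M HM] k : exists M : R, forall s,
      `|complex.Re (F s i k)| + `|complex.Im (F s i k)| <= M.
    have [[_ [M1 h1]] [_ [M2 h2]]] := bF i k.
    by exists (M1 + M2) => s; rewrite lerD.
  by exists M.
exists (\sum_i \sum_k M i k) => s.
by apply: ler_sum => i _; apply: ler_sum => k _; exact: HM.
Qed.

Lemma mx_expectationE F : mx_bounded F -> mx_expectation Q F = \matrix_(i, k)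
  ((\int[Q]_s complex.Re (F s i k)) +i* (\int[Q]_s complex.Im (F s i k))).
Proof.
move=> bF; apply/matrixP => i k; rewrite !mxE; have [bRe bIm] := bF i k.
by rewrite !expectationEb.
Qed.

Lemma mx_expectation_herm F : mx_bounded F -> (forall s, F s \is hermsymmx) ->
  mx_expectation Q F \is hermsymmx.
Proof.
move=> bF hF; apply: hermI; rewrite mx_expectationE//.
have FE s i k : F s k i = Num.conj (F s i k) by rewrite -{1}(hermP (hF s)) !mxE.
apply/matrixP => i k; rewrite !mxE conjC_ReIm /=; congr (_ +i* _).
  by apply: eq_Rintegral => s _; rewrite [F s k i]FE conjC_ReIm /=.
rewrite -RintegralNb; last by have [] := bF k i.
by apply: eq_Rintegral => s _; rewrite [F s k i]FE conjC_ReIm /= opprK.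
Qed.

Lemma qform_entries (C : 'M[R[i]]_d) (v : 'cV[R[i]]_d) :
  qform C v = \sum_i \sum_k
    (complex.Re (Num.conj (v i 0) * v k 0) * complex.Re (C i k) -
     complex.Im (Num.conj (v i 0) * v k 0) * complex.Im (C i k)).
Proof.
rewrite /qform dotcE Re_sum; apply: eq_bigr => i _.
rewrite mxE mulr_sumr Re_sum; apply: eq_bigr => k _.
by rewrite -ReM; congr complex.Re; ring.
Qed.

(** For fixed [B] the trace is a real-linear function of the real and imaginary parts of the
    entries. This serves to integrate out the independent copy. *)
Lemma Rintegral_trexp th F (B : 'M[R[i]]_d) : mx_bounded F ->
  \int[Q]_s trexp th (F s) B = trexp th (mx_expectation Q F) B.
Proof.
move=> bF; rewrite mx_expectationE//.
have bsum v : bounded_measurable (fun s => qform (F s) v) /\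
    \int[Q]_s qform (F s) v = qform (\matrix_(i, k)
  ((\int[Q]_s complex.Re (F s i k)) +i* (\int[Q]_s complex.Im (F s i k)))) v.
  have bterm i k : bounded_measurable (fun s =>
     complex.Re (Num.conj (v i 0) * v k 0) * complex.Re (F s i k) -
     complex.Im (Num.conj (v i 0) * v k 0) * complex.Im (F s i k)).
    have [bRe bIm] := bF i k.
    by apply: bounded_measurableD; [|apply: bounded_measurableN];
       exact: bounded_measurableZ.
  split.
    under eq_fun do rewrite qform_entries.
    by apply: bounded_measurable_sum => i; exact: bounded_measurable_sum.
  under eq_Rintegral do rewrite qform_entries.
  rewrite Rintegral_sumb => [|i]; last exact: bounded_measurable_sum.
  rewrite qform_entries; apply: eq_bigr => i _.
  rewrite Rintegral_sumb//; apply: eq_bigr => k _.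
  have [bRe bIm] := bF i k; rewrite mxE /=.
  rewrite RintegralDb ?RintegralNb ?RintegralZb//; first exact: bounded_measurableZ.
  - exact: bounded_measurableZ.
  - by apply: bounded_measurableN; exact: bounded_measurableZ.
rewrite Rintegral_sumb => [|i]; last by apply: bounded_measurableZ; have [] := bsum (eigvec B i).
apply: eq_bigr => i _; have [b <-] := bsum (eigvec B i).
by rewrite RintegralZb.
Qed.

Lemma bounded_measurable_trexp th F (G : S -> 'M[R[i]]_d) : 0 <= th ->
  mx_bounded F -> mx_bounded G -> (forall s, G s \is hermsymmx) ->
  bounded_measurable (fun s => trexp th (F s) (G s)).
Proof.
move=> th0 bF bG hG; split.
  apply: measurable_trexp => // i k.
    by have [[? _] [? _]] := bF i k.
  by have [[? _] [? _]] := bG i k.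
have [M FM] := mx_bounded_ent1norm bF; have [N GN] := mx_bounded_ent1norm bG.
exists (d%:R * (expR (th * N) * M)) => s.
rewrite (le_trans (trexp_bound _ (hG s) th0))// ler_wpM2l//.
by rewrite ler_pM ?expR_ge0 ?ent1norm_ge0// ler_expR ler_wpM2l.
Qed.

Lemma mx_bounded_cst (A : 'M[R[i]]_d) : mx_bounded (fun=> A).
Proof. by move=> i k; split; exact: bounded_measurable_cst. Qed.

Lemma mx_boundedB F (G : S -> 'M[R[i]]_d) : mx_bounded F -> mx_bounded G ->
  mx_bounded (fun s => F s - G s).
Proof.
move=> bF bG i k; have [bFr bFi] := bF i k; have [bGr bGi] := bG i k; split.
  under eq_fun do rewrite !mxE ReD ReN.
  by apply: bounded_measurableD => //; exact: bounded_measurableN.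
under eq_fun do rewrite !mxE ImD ImN.
by apply: bounded_measurableD => //; exact: bounded_measurableN.
Qed.

End MatrixExpectation.

(* The equational hypotheses keep integrals out of the goal given to lra, which
   is very slow at reifying them. *)
Lemma antisym_halving {R : realFieldType} (u X Y a nb b z c c1 c2 : R) :
  X <= Y -> X = a + nb -> nb = - b -> a = - b ->
  Y = u * z -> z = c1 + c2 -> c1 = c -> c2 = c -> a <= u * c.
Proof.
by move=> XY XE nbE aE YE zE c1E c2E; move: XY; rewrite XE nbE -aE YE zE c1E c2E; lra.
Qed.

(** * Interpolation between two points of the product *)

Section Hybrids.
Context {n : nat} {T : 'I_n -> ptopologicalType}.
Notation E := (borel (prod_topology T)).
Implicit Types x y : E.

(* The first k coordinates come from y. *)
Definition hybrid (k : nat) x y : E := select [set j : 'I_n | (k <= j)%N] x y.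

Lemma hybridE k x y j : hybrid k x y j = if (k <= j)%N then x j else y j.
Proof. by rewrite /hybrid /select inE. Qed.

Lemma hybrid0 x y : hybrid 0 x y = x.
Proof. by apply: functional_extensionality_dep => j; rewrite hybridE. Qed.

Lemma hybridn x y : hybrid n x y = y.
Proof. by apply: functional_extensionality_dep => j; rewrite hybridE leqNgt ltn_ord. Qed.

(** The new value is presented as a coordinate of a point [y], so that both branches are well typed
    without a transport along j = k. *)
Lemma dfwithE x (k : 'I_n) (a : T k) (j : 'I_n) (y : E) : y k = a ->
  dfwith x k a j = if j == k then y j else x j.
Proof.
move=> <-; have [->|jk] := eqVneq j k; first by rewrite dfwithin.
by rewrite dfwithout// eq_sym.
Qed.

Lemma select1E (k : 'I_n) x y : select [set k] y x = dfwith x k (y k).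
Proof.
by apply: functional_extensionality_dep => j; rewrite (dfwithE _ _ (erefl (y k))) /select inE.
Qed.

Lemma hybridS (k : 'I_n) x y : hybrid k.+1 x y = dfwith (hybrid k x y) k (y k).
Proof.
apply: functional_extensionality_dep => j.
rewrite (dfwithE _ _ (erefl (y k))) !hybridE -val_eqE /=.
by case: (ltngtP k j).
Qed.

(** Consecutive hybrids differ only at [k], where the earlier one reads [x] and the later one [y].
    Together with [hybridS_swap] this is the sign change of D_k. *)
Lemma hybrid_swap (k : 'I_n) x y :
  hybrid k (select [set k] y x) (select [set k] x y) = hybrid k.+1 x y.
Proof.
apply: functional_extensionality_dep => j; rewrite !hybridE /select inE -val_eqE /=.
by case: (ltngtP k j).
Qed.

Lemma hybridS_swap (k : 'I_n) x y :
  hybrid k.+1 (select [set k] y x) (select [set k] x y) = hybrid k x y.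
Proof.
apply: functional_extensionality_dep => j; rewrite !hybridE /select inE -val_eqE /=.
by case: (ltngtP k j).
Qed.

End Hybrids.

(** * The exchangeable pairs argument for H(Z) *)

Section MatrixMcDiarmid.
Context {R : realType} {dO : measure_display} {Omega : measurableType dO}.
Context (P : probability Omega R) {n d : nat} {T : 'I_n -> ptopologicalType}.
Hypothesis d_gt0 : (0 < d)%N.
Hypothesis polishT : polish R (prod_topology T).
Variable Z : forall j : 'I_n, {RV P >-> borel (T j)}.
Hypothesis indepZ : mutually_independent P (fun j => Z j : Omega -> borel (T j)).
Notation E := (borel (prod_topology T)).
Variable H : E -> 'M[R[i]]_d.
Hypothesis H_herm : forall z, H z \is hermsymmx.
Hypothesis H_meas : mx_measurable H.
Variable A : 'I_n -> 'M[R[i]]_d.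
(** Coordinatewise: a point may mix values attained at different samples, as hybrids do. *)
Definition in_range (z : E) : Prop := forall k, range (Z k) (z k).
Hypothesis H_diff : forall (j : 'I_n) (z : E) (z' : T j),
  in_range z -> range (Z j) z' ->
  loewner_le ((H z - H (dfwith z j z')) ^+ 2) (A j ^+ 2).

Let J := joint Z.
Let J2 := joint2 Z.

Lemma in_range_joint w : in_range (J w).
Proof. by move=> k; exists w. Qed.

Lemma in_range_select I x y : in_range x -> in_range y -> in_range (select I x y).
Proof. by move=> hx hy k; rewrite /select; case: (k \in I). Qed.

Lemma in_range_hybrid k x y : in_range x -> in_range y -> in_range (hybrid k x y).
Proof. exact: in_range_select. Qed.

Lemma herm_subH x y : H x - H y \is hermsymmx.
Proof. by apply: hermI; rewrite linearB/= map_mxB !hermP. Qed.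

Lemma hybrid_diff_loewner (k : 'I_n) x y : in_range x -> in_range y ->
  loewner_le ((H (hybrid k x y) - H (hybrid k.+1 x y)) ^+ 2) (A k ^+ 2).
Proof.
by move=> hx hy; rewrite hybridS; apply: H_diff => //; exact: in_range_hybrid.
Qed.

Lemma hybrid_telescope x y :
  H x - H y = \sum_(k < n) (H (hybrid k x y) - H (hybrid k.+1 x y)).
Proof.
rewrite -(big_mkord xpredT (fun k => H (hybrid k x y) - H (hybrid k.+1 x y))).
under eq_bigr do rewrite -opprB.
by rewrite sumrN telescope_sumr// hybrid0 hybridn opprB.
Qed.

(** The deviation from one reference value of [H] telescopes into n differences, and each has its
    entries bounded through A_k^2. *)
Lemma entry_bounded : exists M : R, forall z, in_range z -> forall i k,
  `|complex.Re (H z i k)| <= M /\ `|complex.Im (H z i k)| <= M.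
Proof.
(* A reference sample exists, since an empty space could not have probability 1. *)
have [w0 _] : [set: Omega] !=set0.
  apply/set0P/eqP => O0; have := probability_setT P.
  by rewrite O0 measure0 => /eqP; rewrite eqe eq_sym oner_eq0.
pose C := \sum_(k < n) Num.sqrt (ent1norm (A k ^+ 2)).
have dC z i k : in_range z ->
    `|complex.Re (H z i k - H (J w0) i k)| <= C /\
    `|complex.Im (H z i k - H (J w0) i k)| <= C.
  move=> hz; have /matrixP/(_ i k) := hybrid_telescope z (J w0).
  rewrite !mxE summxE => ->; rewrite Re_sum Im_sum.
  have b (j : 'I_n) : abs2 ((H (hybrid j z (J w0)) - H (hybrid j.+1 z (J w0))) i k)
      <= ent1norm (A j ^+ 2).
    apply: loewner_sqr_entry; first exact: herm_subH.
    by apply: hybrid_diff_loewner => //; exact: in_range_joint.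
  split; rewrite (le_trans (ler_norm_sum _ _ _))//; apply: ler_sum => j _.
    by rewrite (le_trans (Re_le_sqrt _))// ler_wsqrtr.
  rewrite -sqrtr_sqr ler_wsqrtr// (le_trans _ (b j))//.
  by rewrite lerDr sqr_ge0.
exists (C + ent1norm (H (J w0))) => z hz i k.
have [hRe hIm] := dC z i k hz.
have h0 : `|complex.Re (H (J w0) i k)| + `|complex.Im (H (J w0) i k)| <= ent1norm (H (J w0)).
  rewrite /ent1norm (bigD1 i)//= (bigD1 k)//= -addrA lerDl addr_ge0//.
    by apply: sumr_ge0 => *; rewrite addr_ge0.
  by apply: sumr_ge0 => *; apply: sumr_ge0 => *; rewrite addr_ge0.
rewrite -(subrK (H (J w0) i k) (H z i k)) ReD ImD.
split; rewrite (le_trans (ler_normD _ _))// lerD// (le_trans _ h0)//.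
  by rewrite lerDl.
by rewrite lerDr.
Qed.

Lemma mx_bounded_range dS (S : measurableType dS) (phi : S -> E) :
  measurable_fun setT phi -> (forall s, in_range (phi s)) ->
  mx_bounded (fun s => H (phi s)).
Proof.
move=> mphi rphi; have [M HM] := entry_bounded.
have mH := mx_measurable_comp H_meas mphi.
by move=> i k; have [? ?] := mH i k; split; split => //; exists M => s;
  have [] := HM _ (rphi s) i k.
Qed.

Definition centered (z : E) : 'M[R[i]]_d := H z - mx_expectation P (fun w => H (J w)).

Let mJ : measurable_fun setT J := measurable_joint polishT Z.

Lemma mx_bounded_joint : mx_bounded (fun w => H (J w)).
Proof. by apply: mx_bounded_range => // w; exact: in_range_joint. Qed.

Lemma centered_herm z : centered z \is hermsymmx.
Proof.
apply: hermI; rewrite linearB/= map_mxB !hermP//.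
by apply: mx_expectation_herm => //; exact: mx_bounded_joint.
Qed.

Lemma mx_bounded_centered dS (S : measurableType dS) (phi : S -> E) :
  measurable_fun setT phi -> (forall s, in_range (phi s)) ->
  mx_bounded (fun s => centered (phi s)).
Proof.
move=> mphi rphi; apply: mx_boundedB; first exact: mx_bounded_range.
exact: mx_bounded_cst.
Qed.

Lemma mx_measurable_centered : mx_measurable centered.
Proof. by apply: mx_measurableB => //; exact: mx_measurable_cst. Qed.

Lemma centeredB x y : centered x - centered y = H x - H y.
Proof. by rewrite /centered opprB addrA subrK. Qed.

Definition hybrid_term th (k : nat) (x : E * E) : R :=
  trexp th (H (hybrid k x.1 x.2) - H (hybrid k.+1 x.1 x.2)) (centered x.1).

Lemma measurable_hybrid k : measurable_fun setT (fun x : E * E => hybrid k x.1 x.2).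
Proof. by apply: (measurable_select polishT). Qed.

Lemma measurable_hybrid_term th k : measurable_fun setT (hybrid_term th k).
Proof.
apply: measurable_trexp.
- apply: mx_measurableB; apply: (mx_measurable_comp H_meas); exact: measurable_hybrid.
- by apply: (mx_measurable_comp mx_measurable_centered).
- by move=> x; exact: centered_herm.
Qed.

(** The pair in the difference and the point in the exponent vary separately: after the exchange the
    exponent sits at X^(k) while the difference keeps the original pair. *)
Lemma bounded_hybrid_term th k dS (S : measurableType dS) (psi : S -> E * E)
    (phi : S -> E) : 0 <= th ->
  measurable_fun setT psi -> (forall s, in_range (psi s).1 /\ in_range (psi s).2) ->
  measurable_fun setT phi -> (forall s, in_range (phi s)) ->
  bounded_measurable (fun s => trexp th
    (H (hybrid k (psi s).1 (psi s).2) - H (hybrid k.+1 (psi s).1 (psi s).2))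
    (centered (phi s))).
Proof.
move=> th0 mpsi rpsi mphi rphi; apply: bounded_measurable_trexp => //; last first.
- by move=> s; exact: centered_herm.
- exact: mx_bounded_centered.
- by apply: mx_boundedB; apply: mx_bounded_range;
    do ?[by move=> s; have [? ?] := rpsi s; exact: in_range_hybrid];
    exact: (measurableT_comp (measurable_hybrid _) mpsi).
Qed.

Let mJ2 : measurable_fun setT J2 := measurable_joint2 polishT Z.
Let mJ2fst : measurable_fun setT (fun w => (J2 w).1) :=
  measurableT_comp measurable_fst mJ2.
Let mJ2snd : measurable_fun setT (fun w => (J2 w).2) :=
  measurableT_comp measurable_snd mJ2.

Lemma in_range_joint2 w : in_range (J2 w).1 /\ in_range (J2 w).2.
Proof. by split; exact: in_range_joint. Qed.

Lemma in_range_pair_swap I w :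
  in_range (pair_swap I (J2 w)).1 /\ in_range (pair_swap I (J2 w)).2.
Proof. by split; apply: in_range_select; exact: in_range_joint. Qed.

Lemma Rintegral_joint2_fst (f : E -> R) :
  bounded_measurable (fun w : Omega * Omega => f (J2 w).1) ->
  \int[(P \x P)%E]_w f (J2 w).1 = \int[P]_w f (J w).
Proof.
move=> bf; rewrite Rintegral_product//; apply: eq_Rintegral => w _.
exact: (Rintegral_prob_cst P (f (J w))).
Qed.

Lemma Rintegral_hybrid_term (k : 'I_n) th : 0 <= th ->
  \int[(P \x P)%E]_w hybrid_term th k (J2 w) <=
  th * \int[P]_w trexp th (A k ^+ 2) (centered (J w)).
Proof.
move=> th0; pose I := [set k]%SET.
(* Z with its k-th coordinate taken from the copy Z', so [centered (x' w)] is X^(k). *)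
pose x' w := (pair_swap I (J2 w)).1.
have mx' : measurable_fun setT x'.
  apply: (measurableT_comp measurable_fst).
  by apply: measurableT_comp mJ2; exact: (measurable_pair_swap polishT).
have rx' w : in_range (x' w) by have [] := in_range_pair_swap I w.
pose D w := H (hybrid k (J2 w).1 (J2 w).2) - H (hybrid k.+1 (J2 w).1 (J2 w).2).
have b1 : bounded_measurable (fun w => hybrid_term th k (J2 w)).
  exact: (@bounded_hybrid_term th k _ _ J2 (fun w => (J2 w).1) th0 mJ2
    in_range_joint2 mJ2fst (fun w => (in_range_joint2 w).1)).
have b2 : bounded_measurable (fun w => trexp th (D w) (centered (x' w))).
  exact: (@bounded_hybrid_term th k _ _ J2 x' th0 mJ2 in_range_joint2 mx' rx').
have swapE w : hybrid_term th k (pair_swap I (J2 w)) = - trexp th (D w) (centered (x' w)).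
  by rewrite /hybrid_term /= hybrid_swap hybridS_swap -trfunN opprB.
have e1 : \int[(P \x P)%E]_w hybrid_term th k (J2 w) =
    - \int[(P \x P)%E]_w trexp th (D w) (centered (x' w)).
  rewrite (Rintegral_exchange polishT indepZ (J := I) (measurable_hybrid_term th k)).
  - by rewrite -RintegralNb//; apply: eq_Rintegral => w _; rewrite swapE.
  - by case: b1.
  - by case: b2 => _ [M h]; exists M => w; rewrite swapE normrN.
pose G (x : E * E) := trexp th (A k ^+ 2) (centered x.1).
have bG (phi : Omega * Omega -> E) : measurable_fun setT phi ->
    (forall w, in_range (phi w)) ->
    bounded_measurable (fun w => trexp th (A k ^+ 2) (centered (phi w))).
  move=> mphi rphi; apply: bounded_measurable_trexp => //.
  - exact: mx_bounded_cst.
  - exact: mx_bounded_centered.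
  - by move=> w; exact: centered_herm.
have bG1 := bG _ mJ2fst (fun w => (in_range_joint2 w).1).
have bG2 := bG _ mx' rx'.
have e0 : \int[(P \x P)%E]_w trexp th (A k ^+ 2) (centered (J2 w).1) =
    \int[P]_w trexp th (A k ^+ 2) (centered (J w)).
  exact: (@Rintegral_joint2_fst (fun z => trexp th (A k ^+ 2) (centered z)) bG1).
(* The same exchange, now applied to a function of the first point alone, shows that X^(k) and X
   give this trace the same mean. *)
have e2 : \int[(P \x P)%E]_w trexp th (A k ^+ 2) (centered (x' w)) =
    \int[P]_w trexp th (A k ^+ 2) (centered (J w)).
  rewrite -e0.
  have mG : measurable_fun setT G.
    apply: measurable_trexp; first exact: mx_measurable_cst.
      by apply: (mx_measurable_comp mx_measurable_centered).
    by move=> x; exact: centered_herm.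
  case: (bG1) => _ bG1'; case: (bG2) => _ bG2'.
  exact: (esym (Rintegral_exchange polishT indepZ (J := I) mG bG1' bG2')).
have e3 : \int[(P \x P)%E]_w (hybrid_term th k (J2 w) +
     - trexp th (D w) (centered (x' w))) <=
   \int[(P \x P)%E]_w (th * (trexp th (A k ^+ 2) (centered (J2 w).1) +
      trexp th (A k ^+ 2) (centered (x' w)))).
  apply: le_Rintegralb.
  - by apply: bounded_measurableD => //; exact: bounded_measurableN.
  - by apply: bounded_measurableZ; exact: bounded_measurableD.
  move=> w; have [r1 r2] := in_range_joint2 w.
  have l1 : loewner_le ((centered (J2 w).1 - centered (x' w)) ^+ 2) (A k ^+ 2).
    rewrite centeredB /x' /pair_swap /fst select1E.
    by apply: H_diff; [exact: r1|exact: r2].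
  have l2 : loewner_le (D w ^+ 2) (A k ^+ 2) by exact: hybrid_diff_loewner r1 r2.
  exact: (trexp_mean_value (centered_herm _) (centered_herm _) (herm_subH _ _) th0 l1 l2).
have e4 := RintegralDb (P \x P)%E b1 (bounded_measurableN b2).
have e5 := RintegralNb (P \x P)%E b2.
have e6 := RintegralZb (P \x P)%E th (bounded_measurableD bG1 bG2).
have e7 := RintegralDb (P \x P)%E bG1 bG2.
exact: (antisym_halving e3 e4 e5 e1 e6 e7 e0 e2).
Qed.

Lemma bounded_trexp_joint th (F : Omega -> 'M[R[i]]_d) : 0 <= th -> mx_bounded F ->
  bounded_measurable (fun w => trexp th (F w) (centered (J w))).
Proof.
move=> th0 bF; apply: bounded_measurable_trexp => //.
- by apply: mx_bounded_centered => // w; exact: in_range_joint.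
- by move=> w; exact: centered_herm.
Qed.

Lemma Rintegral_trexp_centered th : 0 <= th ->
  \int[P]_w trexp th (centered (J w)) (centered (J w)) <=
  th * specnorm (\sum_(j < n) A j ^+ 2) *
    \int[P]_w trexp th 1%:M (centered (J w)).
Proof.
move=> th0.
have bH (k : 'I_n) : bounded_measurable (fun w => hybrid_term th k (J2 w)).
  exact: (@bounded_hybrid_term th k _ _ J2 (fun w => (J2 w).1) th0 mJ2
    in_range_joint2 mJ2fst (fun w => (in_range_joint2 w).1)).
have sumE w : \sum_(k < n) hybrid_term th k (J2 w) =
    trexp th (H (J w.1) - H (J w.2)) (centered (J w.1)).
  by rewrite /trexp hybrid_telescope trfun_sum.
(* Integrating out the second copy turns H(Z') into E H(Z), so the telescoped difference becomes
   X. *)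
have -> : \int[P]_w trexp th (centered (J w)) (centered (J w)) =
    \sum_(k < n) \int[(P \x P)%E]_w hybrid_term th k (J2 w).
  rewrite -Rintegral_sumb// Rintegral_product; last exact: bounded_measurable_sum.
  apply: eq_Rintegral => w _; under eq_Rintegral do rewrite sumE /=.
  set B := centered (J w).
  have bB : bounded_measurable (fun w' => trexp th (H (J w')) B).
    apply: bounded_measurable_trexp => //; first exact: mx_bounded_joint.
      exact: mx_bounded_cst.
    by move=> _; exact: centered_herm.
  rewrite {1}/B /centered /trexp trfunD trfunN.
  under [RHS]eq_Rintegral do rewrite trfunD trfunN.
  rewrite RintegralDb; [|exact: bounded_measurable_cst|exact: bounded_measurableN].
  rewrite Rintegral_prob_cst RintegralNb//; congr (_ - _).
  by symmetry; apply: Rintegral_trexp; exact: mx_bounded_joint.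
have bA (k : 'I_n) : bounded_measurable (fun w => trexp th (A k ^+ 2) (centered (J w))).
  by apply: bounded_trexp_joint => //; exact: mx_bounded_cst.
apply: (@le_trans _ _ (\sum_(k < n) th * \int[P]_w trexp th (A k ^+ 2) (centered (J w)))).
  by apply: ler_sum => k _; exact: Rintegral_hybrid_term.
rewrite -mulr_sumr -mulrA ler_wpM2l// -Rintegral_sumb// -RintegralZb; last first.
  by apply: bounded_trexp_joint => //; exact: mx_bounded_cst.
apply: le_Rintegralb; first exact: bounded_measurable_sum.
- by apply: bounded_measurableZ; apply: bounded_trexp_joint => //; exact: mx_bounded_cst.
- by move=> w; rewrite /trexp -trfun_sum; exact: trexp_specnorm.
Qed.

(** With g the mean trace exponential, the integrated tangent inequality at [b] and the Stein bound
    give g(b) - g(a) <= (b - a) b s g(b), which is the hypothesis of [gronwall_sqr]. The value g(0)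
    = d counts the eigenvalues. *)
Lemma trexp_mgf (s th : R) : 0 <= s -> s = specnorm (\sum_(j < n) A j ^+ 2) -> 0 <= th ->
  \int[P]_w trexp th 1%:M (centered (J w)) <= d%:R * expR (th ^+ 2 * s / 2).
Proof.
move=> s0 sE th0.
have b1 t : 0 <= t -> bounded_measurable (fun w => trexp t 1%:M (centered (J w))).
  by move=> t0; apply: bounded_trexp_joint => //; exact: mx_bounded_cst.
have pos t : 0 <= \int[P]_w trexp t 1%:M (centered (J w)).
  apply: Rintegral_ge0 => w _; rewrite /trexp trfun_id.
  by apply: sumr_ge0 => i _; exact: expR_ge0.
have -> : d%:R = \int[P]_w trexp 0 1%:M (centered (J w)).
  rewrite -[LHS](Rintegral_prob_cst P); apply: eq_Rintegral => w _.
  rewrite /trexp trfun_id; under eq_bigr do rewrite mul0r expR0.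
  by rewrite sumr_const card_ord.
apply: (gronwall_sqr (g := fun t => \int[P]_w trexp t 1%:M (centered (J w)))) => //.
move=> a b a0 ab; have b0 := le_trans a0 ab.
have bc : bounded_measurable (fun w => trexp b (centered (J w)) (centered (J w))).
  apply: bounded_trexp_joint => //; apply: mx_bounded_centered => // w.
  exact: in_range_joint.
have h1 : \int[P]_w (trexp b 1%:M (centered (J w)) - trexp a 1%:M (centered (J w))) <=
    \int[P]_w ((b - a) * trexp b (centered (J w)) (centered (J w))).
  apply: le_Rintegralb.
  - by apply: bounded_measurableD; [exact: b1|apply: bounded_measurableN; exact: b1].
  - exact: bounded_measurableZ.
  - by move=> w; apply: trexp_convex; exact: centered_herm.
rewrite RintegralZb// RintegralDb ?RintegralNb in h1; try exact: b1;
  try (apply: bounded_measurableN; exact: b1).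
have h2 := Rintegral_trexp_centered b0; rewrite -sE in h2.
have ba : 0 <= b - a by rewrite subr_ge0.
have := ler_wpM2l ba h2; move: h1.
set u := \int[P]_w _; set v := \int[P]_w _; set x := \int[P]_w _ => h1 h3.
rewrite mulrBr mulr1 lerBlDr -lerBlDl (le_trans h1)// (le_trans h3)//.
by rewrite le_eqVlt; apply/orP; left; apply/eqP; ring.
Qed.

Lemma measurable_lambda_max_joint :
  measurable_fun setT (fun w => lambda_max (centered (J w))).
Proof.
apply: measurable_lambda_max => //; last by move=> w; exact: centered_herm.
exact: (mx_measurable_comp mx_measurable_centered mJ).
Qed.

Lemma bounded_lambda_max_joint :
  bounded_measurable (fun w => lambda_max (centered (J w))).
Proof.
split; first exact: measurable_lambda_max_joint.
have [M HM] := mx_bounded_ent1norm (mx_bounded_centered mJ in_range_joint).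
exists M => w; have [[i ->] _] := lambda_max_attained d_gt0 (centered_herm (J w)).
by rewrite (le_trans (eigval_bound _ (centered_herm _))).
Qed.

Lemma lambda_max_tail (s th t : R) : 0 <= s ->
  s = specnorm (\sum_(j < n) A j ^+ 2) -> 0 <= th ->
  (P [set w | (t <= lambda_max (centered (J w)))%R] <=
    (d%:R * expR (th ^+ 2 * s / 2 - th * t))%:E)%E.
Proof.
move=> s0 sE th0; set B := [set w | _].
have mB : measurable B.
  have := measurable_lambda_max_joint measurableT (measurable_itv `[t, +oo[).
  rewrite setTI; congr measurable; apply/seteqP; split => w; rewrite /B /= in_itv/= andbT//.
have bB : bounded_measurable (\1_B : Omega -> R).
  split; first exact: measurable_indic.
  by exists 1 => w; rewrite indicE ger0_norm// lern1 leq_b1.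
have bt : bounded_measurable (fun w => trexp th 1%:M (centered (J w))).
  by apply: bounded_trexp_joint => //; exact: mx_bounded_cst.
rewrite -(expectation_indic P mB) expectationEb// lee_fin.
apply: (@le_trans _ _ (\int[P]_w (expR (- (th * t)) * trexp th 1%:M (centered (J w))))).
  apply: le_Rintegralb => //; first exact: bounded_measurableZ.
  move=> w; have h := expR_lambda_max_le th d_gt0 (centered_herm (J w)).
  rewrite indicE; case: (boolP (w \in B)) => [/set_mem tw|_]; last first.
    by rewrite mulr_ge0 ?expR_ge0// (le_trans _ h)// expR_ge0.
  rewrite (le_trans _ (ler_wpM2l (expR_ge0 _) h))// -expRD -expR0 ler_expR.
  by rewrite addrC subr_ge0 ler_wpM2l.
rewrite RintegralZb// (le_trans (ler_wpM2l (expR_ge0 _) (trexp_mgf s0 sE th0)))//.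
by rewrite mulrCA -expRD addrC.
Qed.

(** Jensen's inequality in tangent form, 1 + (th lambda - c) <= e^{th lambda - c}, where c = ln d +
    th^2 s / 2 is chosen so that the right side has mean at most 1. *)
Lemma lambda_max_mean (s th : R) : 0 <= s ->
  s = specnorm (\sum_(j < n) A j ^+ 2) -> 0 <= th ->
  th * \int[P]_w lambda_max (centered (J w)) <= ln d%:R + th ^+ 2 * s / 2.
Proof.
move=> s0 sE th0; set c := ln d%:R + _.
have d0 : 0 < d%:R :> R by rewrite ltr0n.
have bt : bounded_measurable (fun w => trexp th 1%:M (centered (J w))).
  by apply: bounded_trexp_joint => //; exact: mx_bounded_cst.
have bl := bounded_lambda_max_joint.
have h : \int[P]_w (th * lambda_max (centered (J w)) + (1 - c)) <=
    \int[P]_w (expR (- c) * trexp th 1%:M (centered (J w))).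
  apply: le_Rintegralb.
  - by apply: bounded_measurableD; [exact: bounded_measurableZ|exact: bounded_measurable_cst].
  - exact: bounded_measurableZ.
  move=> w; have e := expR_lambda_max_le th d_gt0 (centered_herm (J w)).
  rewrite (le_trans _ (ler_wpM2l (expR_ge0 _) e))// -expRD.
  rewrite addrCA (le_trans _ (expR_ge1Dx _))// lerD2l addrC.
  exact: lexx.
have e1 := RintegralDb P (bounded_measurableZ th bl) (bounded_measurable_cst (1 - c)).
have e2 := RintegralZb P th bl.
have e3 := RintegralZb P (expR (- c)) bt.
have e4 := Rintegral_prob_cst P (1 - c).
have e5 := ler_wpM2l (expR_ge0 (- c)) (trexp_mgf s0 sE th0).
have e6 : expR (- c) * (d%:R * expR (th ^+ 2 * s / 2)) = 1.
  by rewrite -{1}(lnK (x := d%:R))// -expRD -expRD -/c addNr expR0.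
rewrite e1 e2 e4 e3 in h; rewrite e6 in e5.
have := le_trans h e5; rewrite addrCA gerDl subr_le0.
exact.
Qed.

End MatrixMcDiarmid.

(** * Choice of [th] and conclusion *)

(** For p > 0 the choice th = D / (p t) gives p e^{th t} >= p (1 + th t) = p + D > D. This settles
    the tail when sigma = 0. *)
Lemma subgaussian_tail_limit {R : realType} (p D t : R) : 0 <= D -> 0 < t ->
  (forall th, 0 <= th -> p <= D * expR (- (th * t))) -> p <= 0.
Proof.
move=> D0 t0 h; rewrite leNgt; apply/negP => p0.
pose th := D / (p * t); have th0 : 0 <= th by rewrite divr_ge0// mulr_ge0// ltW.
have := h th th0; rewrite expRN ler_pdivlMr ?expR_gt0//.
have e := expR_ge1Dx (th * t); apply/negP; rewrite -ltNge.
apply: lt_le_trans (ler_wpM2l (ltW p0) e).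
have -> : p * (1 + th * t) = p + D.
  by rewrite /th; field; rewrite (gt_eqF p0) (gt_eqF t0).
by rewrite ltrDr.
Qed.

(** With th = L / sigma^2 the hypothesis becomes L^2 <= 2 l sigma^2. The minimising th, the root of
    2 l over sigma, would degenerate at l = 0, that is d = 1, while this one is positive once L
    is. *)
Lemma le_sqrt_of_quadratic {R : realType} (L l sigma : R) : 0 <= l -> 0 <= sigma ->
  (forall th, 0 <= th -> th * L <= l + th ^+ 2 * sigma ^+ 2 / 2) ->
  L <= sigma * Num.sqrt (2 * l).
Proof.
move=> l0 sg0 h; rewrite leNgt; apply/negP => rL.
have L0 : 0 < L by apply: le_lt_trans rL; rewrite mulr_ge0// sqrtr_ge0.
have r2 : (sigma * Num.sqrt (2 * l)) ^+ 2 = sigma ^+ 2 * (2 * l).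
  by rewrite exprMn sqr_sqrtr// mulr_ge0.
have rL2 : sigma ^+ 2 * (2 * l) < L ^+ 2.
  by rewrite -r2 ltr_sqr ?nnegrE ?mulr_ge0 ?sqrtr_ge0// ltW.
move: sg0; rewrite le_eqVlt => /orP[/eqP sg|sg].
  (* For sigma = 0 this witness turns the hypothesis into l + 1 <= l. *)
  have := h ((l + 1) / L); rewrite -sg expr0n mulr0 mul0r addr0 divfK ?gt_eqF//.
  by rewrite gerDl ler10 divr_ge0 ?addr_ge0 ?(ltW L0)// => /(_ isT).
have s2 : 0 < sigma ^+ 2 by rewrite exprn_gt0.
have := h (L / sigma ^+ 2); rewrite divr_ge0 ?(ltW L0) ?(ltW s2)// => /(_ isT).
have -> : L / sigma ^+ 2 * L = L ^+ 2 / sigma ^+ 2 by field; rewrite gt_eqF.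
have -> : (L / sigma ^+ 2) ^+ 2 * sigma ^+ 2 / 2 = L ^+ 2 / sigma ^+ 2 / 2.
  by field; rewrite gt_eqF.
move: rL2; rewrite mulrC -ltr_pdivlMr// => rL2.
by move: rL2; set q := L ^+ 2 / _ => q2 q1; lra.
Qed.

Theorem corollary6p1 (R : realType)
    (dO : measure_display) (Omega : measurableType dO) (P : probability Omega R)
    (n d : nat) (d_gt0 : (0 < d)%N)
    (T : 'I_n -> ptopologicalType)
    (polishT : polish R (prod_topology T))
    (Z : forall j : 'I_n, {RV P >-> borel (T j)})
    (indepZ : mutually_independent P (fun j => Z j : Omega -> borel (T j)))
    (H : borel (prod_topology T) -> 'M[R[i]]_d)
    (H_herm : forall z, H z \is hermsymmx)
    (H_meas : mx_measurable H) :
  let HZ : Omega -> 'M[R[i]]_d := fun w => H (fun j => Z j w) in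
  let X : Omega -> 'M[R[i]]_d := fun w => HZ w - mx_expectation P HZ in
  forall
    (X_L2 : ('E_P[fun w => (specnorm (X w) ^+ 2)%R] < +oo)%E)
    (A : 'I_n -> 'M[R[i]]_d)
    (A_herm : forall j, A j \is hermsymmx)
    (H_diff : forall (j : 'I_n) (z : forall k, T k) (z' : T j),
       (forall k, range (Z k) (z k)) -> range (Z j) z' ->
       loewner_le ((H z - H (dfwith z j z')) ^+ 2) (A j ^+ 2))
    (sigma : R) (sigma_ge0 : 0 <= sigma)
    (sigmaE : sigma ^+ 2 = specnorm (\sum_(j < n) A j ^+ 2)),
  (forall t : R, 0 <= t ->
     (P [set w | (t <= lambda_max (X w))%R] <=
      d%:R%:E * expeR (- ((t ^+ 2)%:E / (2 * sigma ^+ 2)%:E)))%E) /\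
  ('E_P[fun w => lambda_max (X w)] <=
     (sigma * Num.sqrt (2 * ln d%:R))%:E)%E.
Proof.
move=> HZ X _ A A_herm H_diff sigma sigma_ge0 sigmaE.
have s0 : 0 <= sigma ^+ 2 by exact: sqr_ge0.
have d0 : 0 < d%:R :> R by rewrite ltr0n.
have tail := lambda_max_tail d_gt0 polishT indepZ H_herm H_meas H_diff _ s0 sigmaE.
have mean := lambda_max_mean d_gt0 polishT indepZ H_herm H_meas H_diff s0 sigmaE.
split=> [t t0|]; last first.
  have bl := bounded_lambda_max_joint d_gt0 polishT H_herm H_meas H_diff.
  rewrite (expectationEb P bl) lee_fin; apply: le_sqrt_of_quadratic => //.
  by rewrite ln_ge0// ler1n.
(* At t = 0 the extended quotient is 0 even for sigma = 0, as 0 times +oo is 0; the bound is [tail]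
   at th = 0. *)
have [t00|tn0] := eqVneq t 0.
  have := tail 0 t (lexx 0); rewrite t00 !mulr0 subr0 expr0n/= !mul0r expR0 mulr1.
  by move=> h; rewrite mul0e oppe0 expeR0 mule1.
have {t0 tn0} t0 : 0 < t by rewrite lt_neqAle eq_sym tn0.
(* For sigma = 0 and t > 0 the quotient is +oo and the right side is 0, so the event must be shown
   to be null, by letting th grow. *)
have [sg0|sgn0] := eqVneq sigma 0.
  rewrite sg0 expr0n mulr0 inver eqxx gt0_muley ?lte_fin ?exprn_gt0//= mule0.
  set B := [set w | _].
  have PBfin : P B \is a fin_num.
    rewrite ge0_fin_numE//; apply: le_lt_trans (tail 0 t (lexx 0)) _.
    exact: ltry.
  rewrite -(fineK PBfin) lee_fin.
  apply: (subgaussian_tail_limit (ltW d0) t0) => th th0.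
  have := tail th t th0; rewrite -/B -(fineK PBfin) lee_fin.
  by rewrite sg0 expr0n mulr0 mul0r sub0r.
have sg : 0 < sigma ^+ 2 by rewrite exprn_gt0// lt_neqAle eq_sym sgn0.
(* The minimiser of th^2 sigma^2 / 2 - th t, with value - t^2 / (2 sigma^2). *)
have th0 : 0 <= t / sigma ^+ 2 by rewrite divr_ge0// ltW.
apply: le_trans (tail _ t th0) _.
rewrite inver mulf_eq0 pnatr_eq0/= gt_eqF//.
have -> : expeR (- ((t ^+ 2)%:E * ((2 * sigma ^+ 2)^-1)%:E))%E =
  (expR (- (t ^+ 2 / (2 * sigma ^+ 2))))%:E by [].
rewrite -EFinM lee_fin.
rewrite ler_wpM2l// ler_expR le_eqVlt; apply/orP; left; apply/eqP.
by field.
Qed.
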